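(* Let $M$ be a manifold of dimension $n\ge 2$ and let $F=\alpha\,\phi\!\left(b^2,\frac{\beta}{\alpha}\right)$ be a Finsler metric on $M$, where $\alpha$ is a Riemannian metric, $\beta$ is a 1-form, $b^2=\|\beta\|_\alpha^2$, and $\phi=\phi(b^2,s)$ is a positive $C^\infty$ function. Suppose that: 1. the function $\phi(b^2,s)$ satisfies the partial differential equation $$\phi_{22}=2(\phi_1-s\phi_{12});$$ 2. $\alpha$ is locally projectively flat, and $\beta$ is closed and conformal with respect to $\alpha$. Then $F$ is locally projectively flat.
   Context: Here $\alpha=\sqrt{a_{ij}(x)y^iy^j}$, $\beta=b_i(x)y^i$, $\|\beta\|_\alpha^2=a^{ij}b_ib_j$ with $(a^{ij})=(a_{ij})^{-1}$. The function $\phi$ has variables $b^2$ and $s$ and domain $\{|s|\le b<b_o\}$ for some $0<b_o\le+\infty$, and $\|\beta\|_\alpha<b_o$ on $M$. Subscripts $1$ and $2$ on $\phi$ denote partial derivatives with respect to the first variable $b^2$ and the second variable $s$, respectively. A Finsler metric on $M$ is a continuous function $F:TM\to[0,\infty)$, $C^\infty$ and positive off the zero section, positively homogeneous of degree one in $y$, with $g_{ij}=\frac12[F^2]_{y^iy^j}$ positive definite at all $y\ne 0$. A Finsler metric on an open domain of $\mathbb R^n$ is projectively flat if all its geodesics are straight lines (as point sets); equivalently its spray coefficients $G^i=\frac14 g^{il}\{[F^2]_{x^ky^l}y^k-[F^2]_{x^l}\}$ have the form $G^i=P(x,y)y^i$. A Finsler (in particular Riemannian) metric on $M$ is locally projectively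 flat if every point of $M$ has a coordinate neighbourhood in which the metric is projectively flat. (For a Riemannian metric this is equivalent to constant sectional curvature, by Beltrami's theorem.) A 1-form is conformal with respect to a Riemannian metric $\alpha$ if its dual vector field with respect to $\alpha$ is a conformal vector field, i.e. $\frac12(b_{i|j}+b_{j|i})=c(x)a_{ij}$ for some function $c(x)$, where $b_{i|j}$ is the covariant derivative of $\beta$ with respect to $\alpha$. *)

(* Defs.v *)
From HB Require Import structures.
From mathcomp Require Export all_boot all_order all_algebra.
From mathcomp Require Export all_classical all_reals all_analysis.

Set Implicit Arguments.
Unset Strict Implicit.
Unset Printing Implicit Defensive.

Export Order.TTheory GRing.Theory Num.Theory.
Export numFieldNormedType.Exports.

Global Open Scope ring_scope.
Global Open Scope classical_set_scope.

(* [iterD [:: v1; ..; vk] f] is D_v1 (.. (D_vk f)). *)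
Definition iterD (R : realType) (V W : normedModType R) (vs : seq V)
    (f : V -> W) : V -> W :=
  foldr (fun v g => fun x => 'D_v g x) f vs.

(* C^oo on an open subset A of a finite-dimensional space (only used for open
   A): all iterated directional derivatives exist and are differentiable. *)
Definition smooth_on (R : realType) (V W : normedModType R) (A : set V)
    (f : V -> W) : Prop :=
  forall (vs : seq V) (x : V), A x -> differentiable (iterD vs f) x.

Section Manifolds.
Context {R : realType} {n : nat}.

(* [cfwd] and [cbwd] are meaningful only on [cdom] and on [cimg]. *)
Record chart (T : Type) := Chart {
  cdom : set T;
  cfwd : T -> 'rV[R]_n;
  cbwd : 'rV[R]_n -> T }.

Definition cimg (T : Type) (c : chart T) : set 'rV[R]_n := cfwd c @` cdom c.

Definition is_chart (T : topologicalType) (c : chart T) : Prop :=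
  [/\ open (cdom c),
      open (cimg c),
      forall p, cdom c p -> cbwd c (cfwd c p) = p,
      {within cdom c, continuous (cfwd c)} &
      {within cimg c, continuous (cbwd c)}].

Definition transition (T : Type) (c d : chart T) : 'rV[R]_n -> 'rV[R]_n :=
  cfwd d \o cbwd c.

Definition overlap (T : Type) (c d : chart T) : set 'rV[R]_n :=
  cfwd c @` (cdom c `&` cdom d).

Definition compatible (T : Type) (c d : chart T) : Prop :=
  smooth_on (overlap c d) (transition c d) /\
  smooth_on (overlap d c) (transition d c).

(* The atlas is maximal, so its members are all the local coordinate systems. *)
Record manifold := Manifold {
  mspace :> topologicalType;
  atlas : set (chart mspace);
  mspace_hausdorff : hausdorff_space mspace;
  mspace_second_countable : @second_countable mspace;
  atlas_chart : forall c, atlas c -> is_chart c;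
  atlas_compatible : forall c d, atlas c -> atlas d -> compatible c d;
  atlas_cover : forall p : mspace, exists2 c, atlas c & cdom c p;
  atlas_maximal : forall c, is_chart c ->
    (forall d, atlas d -> compatible c d) -> atlas c }.

End Manifolds.

Arguments chart R n T : clear implicits.
Arguments manifold R n : clear implicits.

Section LocalCoordinates.
Context {R : realType} {n : nat}.
Implicit Types (x y v : 'rV[R]_n) (F L : 'rV[R]_n -> 'rV[R]_n -> R).

Definition evec (i : 'I_n) : 'rV[R]_n := delta_mx 0 i.

Definition pd (i : 'I_n) (f : 'rV[R]_n -> R) x : R := 'D_(evec i) f x.

Definition pdx (k : 'I_n) L x y : R := pd k (L^~ y) x.

Definition pdy (l : 'I_n) L x y : R := pd l (L x) y.

Definition sqfun F x y : R := F x y ^+ 2.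

(* g_ij = 1/2 [F^2]_{y^i y^j} *)
Definition fundamental_tensor F x y : 'M[R]_n :=
  \matrix_(i, j) (2^-1 * pdy j (pdy i (sqfun F)) x y).

(* G^i = 1/4 g^{il} ([F^2]_{x^k y^l} y^k - [F^2]_{x^l}) *)
Definition spray F x y : 'rV[R]_n :=
  \row_i (4^-1 * \sum_l invmx (fundamental_tensor F x y) i l *
    ((\sum_k pdy l (pdx k (sqfun F)) x y * y 0 k) - pdx l (sqfun F) x y)).

(* A (nonconstant, constant speed) geodesic of F in U, defined on the
   interval I: x'' + 2 G(x, x') = 0. *)
Definition geodesic (U : set 'rV[R]_n) F (I : set R) (x : R -> 'rV[R]_n) :
    Prop :=
  forall t, I t ->
    [/\ U (x t), derivable x t 1, derivable (derive1 x) t 1, derive1 x t != 0 &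
        derive1 (derive1 x) t + 2 *: spray F (x t) (derive1 x t) = 0].

Definition in_straight_line (I : set R) (x : R -> 'rV[R]_n) : Prop :=
  exists p v : 'rV[R]_n, v != 0 /\
    forall t, I t -> exists s : R, x t = p + s *: v.

Definition projectively_flat (U : set 'rV[R]_n) F : Prop :=
  forall (I : set R) (x : R -> 'rV[R]_n),
    open I -> is_interval I -> geodesic U F I x -> in_straight_line I x.

(* Gamma^k_ij of the Riemannian metric with coefficients a *)
Definition christoffel (a : 'rV[R]_n -> 'M[R]_n) x (k i j : 'I_n) : R :=
  2^-1 * \sum_l invmx (a x) k l *
    (pd i (fun z => a z j l) x + pd j (fun z => a z i l) x
     - pd l (fun z => a z i j) x).

(* b_{i|j} *)
Definition covariant_derivative (a : 'rV[R]_n -> 'M[R]_n)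
    (b : 'rV[R]_n -> 'rV[R]_n) x (i j : 'I_n) : R :=
  pd j (fun z => b z 0 i) x - \sum_k christoffel a x k i j * b x 0 k.

End LocalCoordinates.

(* Tensors and functions on TM are given by their expressions in all charts of
   the atlas, related by the usual transformation laws.  In ['J f x] the entry
   (i, j) is the i-th partial derivative of f^j, so that a tangent vector with
   components y in c has components [y *m 'J (transition c d) x] in d. *)
Section GlobalObjects.
Context {R : realType} {n : nat} (M : manifold R n).
Implicit Types (c d : chart R n M) (x y z : 'rV[R]_n).
Implicit Types (a : chart R n M -> 'rV[R]_n -> 'M[R]_n).
Implicit Types (b : chart R n M -> 'rV[R]_n -> 'rV[R]_n).
Implicit Types (F : chart R n M -> 'rV[R]_n -> 'rV[R]_n -> R).

Definition riemannian_metric a : Prop :=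
  (forall c, atlas c ->
    [/\ forall i j, smooth_on (cimg c) (fun x => a c x i j),
        forall x, cimg c x -> (a c x)^T = a c x &
        forall x y, cimg c x -> y != 0 -> 0 < (y *m a c x *m y^T) 0 0]) /\
  (forall c d x, atlas c -> atlas d -> overlap c d x ->
    a c x = 'J (transition c d) x *m a d (transition c d x)
              *m ('J (transition c d) x)^T).

Definition one_form b : Prop :=
  (forall c, atlas c -> forall i, smooth_on (cimg c) (fun x => b c x 0 i)) /\
  (forall c d x, atlas c -> atlas d -> overlap c d x ->
    b c x = b d (transition c d x) *m ('J (transition c d) x)^T).

Definition finsler_metric F : Prop :=
  (forall c, atlas c ->
    [/\ forall x y, cimg c x ->
          0 <= F c x y /\ {for (x, y), continuous (fun p => F c p.1 p.2)},
        smooth_on [set p : 'rV[R]_n * 'rV[R]_n | cimg c p.1 /\ p.2 != 0]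
          (fun p => F c p.1 p.2),
        forall x y, cimg c x -> y != 0 -> 0 < F c x y,
        forall x y (l : R), cimg c x -> 0 < l -> F c x (l *: y) = l * F c x y &
        forall x y z, cimg c x -> y != 0 -> z != 0 ->
          0 < (z *m fundamental_tensor (F c) x y *m z^T) 0 0]) /\
  (forall c d x y, atlas c -> atlas d -> overlap c d x ->
    F c x y = F d (transition c d x) (y *m 'J (transition c d) x)).

Definition locally_projectively_flat F : Prop :=
  forall p : M, exists c,
    [/\ atlas c, cdom c p & projectively_flat (cimg c) (F c)].

Definition alpha_of a c x y : R :=
  Num.sqrt (\sum_i \sum_j a c x i j * y 0 i * y 0 j).

Definition beta_of b c x y : R :=
  \sum_i b c x 0 i * y 0 i.

(* b^2 = a^{ij} b_i b_j *)
Definition sqnorm a b c x : R :=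
  \sum_i \sum_j invmx (a c x) i j * b c x 0 i * b c x 0 j.

(* At y = 0 the right-hand side is 0, since alpha vanishes there. *)
Definition general_alpha_beta (phi : R -> R -> R) a b c x y : R :=
  alpha_of a c x y * phi (sqnorm a b c x) (beta_of b c x y / alpha_of a c x y).

Definition closed_form b : Prop :=
  forall c x i j, atlas c -> cimg c x ->
    pd i (fun z => b c z 0 j) x = pd j (fun z => b c z 0 i) x.

Definition conformal_form a b : Prop :=
  exists k : M -> R, forall c x i j, atlas c -> cimg c x ->
    2^-1 * (covariant_derivative (a c) (b c) x i j +
            covariant_derivative (a c) (b c) x j i)
    = k (cbwd c x) * a c x i j.

End GlobalObjects.

Section Phi.
Context {R : realType}.
Implicit Types phi : R -> R -> R.

(* The pairs (b^2, s) with |s| <= b < bo. *)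
Definition phi_domain (bo : \bar R) : set (R * R) :=
  [set p | exists b : R, [/\ p.1 = b ^+ 2, `|p.2| <= b & (b%:E < bo)%E]].

(* The domain is not open: as usual, smoothness means smoothness of an
   extension to an open neighbourhood.  Here phi denotes such an extension;
   its derivatives on the domain do not depend on the choice, the domain being
   contained in the closure of its interior. *)
Definition smooth_phi (bo : \bar R) phi : Prop :=
  exists O : set (R * R),
    [/\ open O, phi_domain bo `<=` O & smooth_on O (fun p => phi p.1 p.2)].

Definition d1 phi (t s : R) : R := derive1 (phi^~ s) t.

Definition d2 phi (t s : R) : R := derive1 (phi t) s.

End Phi.

(* Main.v *)
Require Import Defs.
From mathcomp Require Import ring lra.

(** In a chart in which the geodesics of alpha are straight, the geodesics of
    F = alpha phi(b^2, beta / alpha) are straight as well.  Write s = beta / alpha and let subscripts l on functions of y be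
    y-derivatives.

    The notion that carries the proof is that of a radial spray,
    G(x, y) = P(x, y) y.  If the spray of F is radial, the acceleration of a
    geodesic is parallel to its velocity, so the Euclidean unit tangent has zero
    derivative and the geodesic is straight ([radial_projectively_flat]).
    Conversely, straightness of the geodesics of alpha gives information about
    its spray at (x, y) only if some geodesic passes through x with velocity y;
    such a geodesic comes from a Picard iteration ([ode_exists],
    [geodesic_exists]), and its acceleration - 2 G(x, y) is then parallel to y
    ([flat_radial]).

    The spray of F is radial as soon as F satisfies Hamel's equations
    F_{x^k y^l} y^k = F_{x^l} ([radial_spray_of_hamel]).  For alpha, radiality
    conversely gives the corresponding equations for alpha^2
    ([alpha_hamel_of_radial]).  As beta is closed and conformal,
    b_{i|j} = c a_ij.  Two consequences are enough: the derivative of b^2 along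
    x^k is 2 c b_k ([isder_sqnorm]), and y^k y^j (d b_j / d x^k) equals
    c alpha^2 + 2 P beta ([conformal_derivative]), where P y is the spray of
    alpha.  Substituting these in Hamel's equations for F, all terms cancel
    except
      c alpha (b_l - s alpha_l) (phi_22 - 2 (phi_1 - s phi_12)),
    which vanishes by the differential equation for phi
    ([general_alpha_beta_radial]).  That equation is available at (b^2, s)
    because |s| <= b by the Cauchy-Schwarz inequality
    ([dual_cauchy_schwarz]). *)

Set Implicit Arguments.
Unset Strict Implicit.
Unset Printing Implicit Defensive.

(** * Differentiation along a direction *)
Section Toolkit.
Context {R : realType} {V : normedModType R}.
Implicit Types (f g : V -> R) (x v : V).

(** Reduces directional derivatives to derivatives of functions of one real
    variable, for which composition and differentiability are well developed.
*)
Lemma is_derive_lineP f x v (df : R) :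
  is_derive x v f df <-> is_derive (0 : R) 1 (fun h : R => f (h *: v + x)) df.
Proof.
have E : 'D_v f x = 'D_1 (fun h : R => f (h *: v + x)) 0.
  rewrite /derive; set g1 := fun h => h^-1 *: _; set g2 := fun h => h^-1 *: _.
  suff -> : g1 = g2 by [].
  by apply/funext => h; rewrite /g1 /g2 /= addr0 scale0r add0r [_%:A]mulr1.
have D := derivable1P f x v.
split=> -[d <-]; split; [exact/D|by rewrite E|exact/D|by rewrite E].
Qed.

Lemma isder_cst (a : R) x v : is_derive x v (fun=> a) 0.
Proof. exact: is_derive_cst. Qed.

Lemma isder_add f g x v (df dg : R) :
  is_derive x v f df -> is_derive x v g dg ->
  is_derive x v (fun z => f z + g z) (df + dg).
Proof. by move=> ? ?; exact: is_deriveD. Qed.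

Lemma isder_sub f g x v (df dg : R) :
  is_derive x v f df -> is_derive x v g dg ->
  is_derive x v (fun z => f z - g z) (df - dg).
Proof. by move=> ? ?; exact: is_deriveB. Qed.

Lemma isder_mul f g x v (df dg : R) :
  is_derive x v f df -> is_derive x v g dg ->
  is_derive x v (fun z => f z * g z) (df * g x + f x * dg).
Proof.
move=> Hf Hg; have H := is_deriveM Hf Hg; apply: is_derive_eq H _.
by rewrite addrC /GRing.scale /= [g x * _]mulrC.
Qed.

Lemma isder_scale f x v (c df : R) :
  is_derive x v f df -> is_derive x v (fun z => c * f z) (c * df).
Proof.
move=> /(isder_mul (isder_cst c x v)) H; apply: is_derive_eq H _.
by rewrite mul0r add0r.
Qed.

Lemma isder_sum (I : Type) (r : seq I) (P : pred I) (F : I -> V -> R)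
    (dF : I -> R) x v :
  (forall i, is_derive x v (F i) (dF i)) ->
  is_derive x v (fun z => \sum_(i <- r | P i) F i z) (\sum_(i <- r | P i) dF i).
Proof.
move=> H; elim: r => [|i r IH].
  apply: is_derive_eq; last by rewrite big_nil.
  rewrite (_ : (fun _ => _) = fun=> 0); first exact: isder_cst.
  by apply/funext => z; rewrite big_nil.
rewrite big_cons (_ : (fun _ => _) =
  fun z => if P i then F i z + \sum_(j <- r | P j) F j z
           else \sum_(j <- r | P j) F j z); last first.
  by apply/funext => z; rewrite big_cons.
by case: (P i) => //; exact: isder_add.
Qed.

Lemma isder_comp (g : R -> R) f x v (df : R) :
  derivable g (f x) 1 -> is_derive x v f df ->
  is_derive x v (fun z => g (f z)) (derive1 g (f x) * df).
Proof.
move=> dg /is_derive_lineP df'; apply/is_derive_lineP.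
apply: is_derive1_comp => /=.
rewrite scale0r add0r derive1E; exact: derivableP.
Qed.

Lemma isder_sqrt f x v (df : R) :
  0 < f x -> is_derive x v f df ->
  is_derive x v (fun z => Num.sqrt (f z)) (df / (2 * Num.sqrt (f x))).
Proof.
move=> f0 H; have [d e] := is_derive1_sqrt f0.
apply: is_derive_eq; first exact: isder_comp d H.
by rewrite derive1E e mulrC.
Qed.

Lemma isder_inv f x v (df : R) :
  f x != 0 -> is_derive x v f df ->
  is_derive x v (fun z => (f z)^-1) (- df / f x ^+ 2).
Proof.
move=> f0 [Hd He]; split; first exact: derivableV.
by rewrite deriveV// He /GRing.scale /=; field.
Qed.

Lemma differentiable_isder f x v : differentiable f x -> is_derive x v f ('D_v f x).
Proof. by move=> /diff_derivable H; exact: derivableP. Qed.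

End Toolkit.

Section Chain2.
Context {R : realType} {V : normedModType R}.

Lemma d1_derive (phi : R -> R -> R) (p : R * R) :
  d1 phi p.1 p.2 = 'D_(1, 0) (fun p => phi p.1 p.2) p.
Proof.
rewrite /d1 derive1E /derive.
set g1 := fun h => h^-1 *: _; set g2 := fun h => h^-1 *: _.
suff -> : g1 = g2 by [].
by apply/funext => h; rewrite /g1 /g2 /= /GRing.scale /= !mulr0 !add0r.
Qed.

Lemma d2_derive (phi : R -> R -> R) (p : R * R) :
  d2 phi p.1 p.2 = 'D_(0, 1) (fun p => phi p.1 p.2) p.
Proof.
rewrite /d2 derive1E /derive.
set g1 := fun h => h^-1 *: _; set g2 := fun h => h^-1 *: _.
suff -> : g1 = g2 by [].
by apply/funext => h; rewrite /g1 /g2 /= /GRing.scale /= !mulr0 !add0r.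
Qed.

Lemma derivable_snd (psi : R -> R -> R) (t s : R) :
  differentiable (fun p : R * R => psi p.1 p.2) (t, s) ->
  derivable (psi t) s 1.
Proof.
move=> H; have := @diff_derivable R (R * R)%type R _ _ (0, 1) H.
rewrite /derivable.
set g1 := fun h => h^-1 *: _; set g2 := fun h => h^-1 *: _.
suff -> : g1 = g2 by [].
by apply/funext => h; rewrite /g1 /g2 /= /GRing.scale /= !mulr0 !add0r.
Qed.

(** The regularity of phi used below: one total derivative for the dependence on
    x, which moves both arguments, and derivatives in s of phi, phi_1 and phi_2
    for the dependence on y, which moves s alone. *)
Lemma smooth_phi_derivable (W : set (R * R)) (phi : R -> R -> R) (t s : R) :
  smooth_on W (fun p => phi p.1 p.2) -> W (t, s) ->
  [/\ differentiable (fun p : R * R => phi p.1 p.2) (t, s),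
      derivable (phi t) s 1, derivable (d1 phi t) s 1 &
      derivable (d2 phi t) s 1].
Proof.
move=> sm Ots.
have D0 := sm [::] _ Ots.
have D1 := sm [:: (1, 0)] _ Ots.
have D2 := sm [:: (0, 1)] _ Ots.
split; first exact: D0.
- exact: derivable_snd.
- apply: derivable_snd; move: D1; rewrite /iterD /=.
  by rewrite (_ : (fun p => d1 phi _ _) = 'D_(1, 0) (fun p => phi p.1 p.2))//;
    apply/funext => p; rewrite d1_derive.
- apply: derivable_snd; move: D2; rewrite /iterD /=.
  by rewrite (_ : (fun p => d2 phi _ _) = 'D_(0, 1) (fun p => phi p.1 p.2))//;
    apply/funext => p; rewrite d2_derive.
Qed.

(** The inner functions are only assumed derivable along v: restricted to a line
    they are differentiable functions of one variable, so the chain rule for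
    total derivatives applies to phi and the curve h |-> (t, s). *)
Lemma isder_comp2 (phi : R -> R -> R) (t s : V -> R) (x v : V) (dt ds : R) :
  differentiable (fun p : R * R => phi p.1 p.2) (t x, s x) ->
  is_derive x v t dt -> is_derive x v s ds ->
  is_derive x v (fun z => phi (t z) (s z))
    (d1 phi (t x) (s x) * dt + d2 phi (t x) (s x) * ds).
Proof.
move=> dphi /is_derive_lineP Ht /is_derive_lineP Hs; apply/is_derive_lineP.
set ph := (fun p : R * R => _) in dphi.
set T := (fun h : R => t _) in Ht; set S := (fun h : R => s _) in Hs.
have T0 : T 0 = t x by rewrite /T scale0r add0r.
have S0 : S 0 = s x by rewrite /S scale0r add0r.
have dT : differentiable T (0:R) by apply/derivable1_diffP.
have dS : differentiable S (0:R) by apply/derivable1_diffP.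
have dP : differentiable (fun h => (T h, S h)) (0:R) by exact: differentiable_pair.
have dphi' : differentiable ph (T 0, S 0) by rewrite T0 S0.
have dC : differentiable (ph \o (fun h => (T h, S h))) (0:R).
  exact: differentiable_comp.
have -> : (fun h => phi (t (h *: v + x)) (s (h *: v + x))) =
  ph \o (fun h => (T h, S h)) by [].
split; first exact/derivable1_diffP.
rewrite deriveE// diff_comp//= diff_pair//=.
rewrite -(deriveE (1:R) dT) -(deriveE (1:R) dS).
have [_ ->] := Ht; have [_ ->] := Hs.
have -> : (dt, ds) = dt *: ((1, 0) : R * R) + ds *: ((0, 1) : R * R).
  by congr (_, _); rewrite /= /GRing.scale /= mulr1 mulr0 ?addr0 ?add0r.
rewrite linearD !linearZ /= -!deriveE// T0 S0.
rewrite -(d1_derive phi (t x, s x)) -(d2_derive phi (t x, s x)) /=.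
by rewrite ![_ *: _]mulrC.
Qed.

End Chain2.

(** * Existence of solutions of ordinary differential equations *)
Section Ode.
Context {R : realType}.

(** The base point -1 of the integral lies to the left of the whole interval
    ]-1, 1[, so that one integral serves for both signs of t; subtracting its
    value at 0 normalizes it. *)
Lemma continuous_antiderivative (g : R -> R) : continuous g ->
  exists G : R -> R, G 0 = 0 /\
    forall t : R, `|t| < 1 -> is_derive t 1 G (g t).
Proof.
move=> gc.
pose F (t : R) := \int[lebesgue_measure]_(x in `[(-1 : R), t]) g x.
have HF (t : R) : `|t| < 1 -> is_derive t 1 F (g t).
  rewrite ltr_norml => /andP[t1 t2].
  have t22 : t < 2 by lra.
  have ig : lebesgue_measure.-integrable `[-1, 2] (EFin \o g).
    apply: continuous_compact_integrable; first exact: segment_compact.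
    exact: continuous_subspaceT.
  have [dF eF] := continuous_FTC1_closed t22 ig t1 (gc t).
  by split; [exact: dF|rewrite -derive1E].
exists (fun t => F t - F 0); split; first by rewrite subrr.
move=> t /HF Ht; have := isder_sub Ht (isder_cst (F 0) t (1 : R)).
by rewrite subr0.
Qed.

(** Replaces estimates of integrals: all bounds in the Picard iteration are
    obtained from bounds on derivatives. *)
Lemma mvt_bound (G g : R -> R) (a M : R) :
  (forall t : R, `|t| < a -> is_derive t 1 G (g t)) ->
  (forall t, `|t| < a -> `|g t| <= M) ->
  forall s t, `|s| < a -> `|t| < a -> `|G t - G s| <= M * `|t - s|.
Proof.
move=> HG Hg.
have key s t : `|s| < a -> `|t| < a -> s < t -> `|G t - G s| <= M * `|t - s|.
  move=> sa ta st.
  have inI c : c \in `[s, t]%R -> `|c| < a.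
    rewrite in_itv /= => /andP[c1 c2].
    move: sa ta; rewrite !ltr_norml => /andP[s1 s2] /andP[t1 t2].
    by apply/andP; split; lra.
  have [c cI ->] := @MVT R G g s t st
     (fun c cI => HG c (inI c (subset_itv_oo_cc cI)))
     (derivable_within_continuous
       (fun c cI => @ex_derive _ _ _ _ _ _ _ (HG c (inI c cI)))).
  rewrite normrM ler_wpM2r//; apply: Hg; apply: inI; exact: subset_itv_oo_cc.
move=> s t sa ta; case: (ltgtP s t) => [st|ts|->].
- exact: key.
- by rewrite distrC [`|t - s|]distrC; exact: key.
- by rewrite !subrr normr0 mulr0.
Qed.

Lemma geometric_slack (a b D : R) :
  (forall k, a <= b + D / 2 ^+ k) -> a <= b.
Proof.
move=> H; apply/ler_addgt0Pr => e e0.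
have [k Hk] : exists k, D / 2 ^+ k <= e.
  have [k Hk] : exists k : nat, `|D| / e <= 2 ^+ k.
    have De0 : 0 <= `|D| / e by rewrite divr_ge0// ltW.
    exists (Num.bound (`|D| / e)); apply: (le_trans (ltW (archi_boundP De0))).
    by rewrite -natrX ler_nat ltnW// ltn_expl.
  exists k; rewrite ler_pdivrMr ?exprn_gt0//.
  apply: (le_trans (ler_norm D)); rewrite mulrC.
  by rewrite ler_pdivrMr in Hk.
by apply: (le_trans (H k)); rewrite lerD2l.
Qed.

(** The intervals of radius 2 C / 2^k about x_k are nested, and the supremum of
    their left ends belongs to all of them. *)
Lemma geometric_limit (x : nat -> R) (C : R) :
  (forall k, `|x k.+1 - x k| <= C / 2 ^+ k) ->
  exists l, forall k, `|x k - l| <= (2 * C) / 2 ^+ k.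
Proof.
move=> Hx.
have C0 : 0 <= C by have := le_trans (normr_ge0 _) (Hx 0); rewrite expr0 divr1.
pose e k : R := (2 * C) / 2 ^+ k.
have eS k : e k.+1 = C / 2 ^+ k.
  by rewrite /e exprS; field; rewrite expf_neq0 //; lra.
have e2 k : e k = C / 2 ^+ k + C / 2 ^+ k by rewrite /e; lra.
have e0 k : 0 <= e k by rewrite /e divr_ge0 ?mulr_ge0 ?exprn_ge0.
have lo : {homo (fun k => x k - e k) : j k / (j <= k)%N >-> j <= k}.
  apply: homo_leq => [//|y z w|k]; first exact: le_trans.
  by move: (Hx k); rewrite ler_norml eS e2 => /andP[h1 h2]; lra.
have hi : {homo (fun k => x k + e k) : j k / (j <= k)%N >-> k <= j}.
  apply: homo_leq => [//|y z w h1 h2|k]; first exact: le_trans h2 h1.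
  by move: (Hx k); rewrite ler_norml eS e2 => /andP[h1 h2]; lra.
have lohi j k : x j - e j <= x k + e k.
  case: (leqP j k) => jk.
    by apply: (le_trans (lo _ _ jk)); have := e0 k; lra.
  by apply: le_trans (hi _ _ (ltnW jk)); have := e0 j; lra.
pose S := range (fun k => x k - e k).
have S0 : S !=set0 by exists (x 0 - e 0); exists 0%N.
have ubS k : ubound S (x k + e k) by move=> _ [j _ <-].
exists (sup S) => k; rewrite -/(e k) ler_norml.
have h1 : sup S <= x k + e k by apply: ge_sup.
have h2 : x k - e k <= sup S.
  by apply: ub_le_sup; [exists (x 0 + e 0)|exists k].
by apply/andP; split; lra.
Qed.

(** Composition with this 1-Lipschitz projection onto [-h, h] turns Lipschitz
    bounds valid on an interval into bounds valid on the whole line. *)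
Definition clamp (h t : R) := Num.max (- h) (Num.min t h).

Lemma clamp_le h t : 0 <= h -> `|clamp h t| <= h.
Proof.
by move=> h0; rewrite /clamp /Num.max /Num.min ler_norml;
  case: ifP; case: ifP => ? ?; apply/andP; split; lra.
Qed.

Lemma clamp_id h t : `|t| <= h -> clamp h t = t.
Proof.
rewrite ler_norml => /andP[h1 h2].
by rewrite /clamp min_l// max_r.
Qed.

Lemma clamp_lipschitz h s t : 0 <= h -> `|clamp h t - clamp h s| <= `|t - s|.
Proof.
move=> h0; wlog st : s t / s <= t.
  move=> H; case: (leP s t) => [|/ltW] st; first exact: H.
  by rewrite distrC [`|t - s|]distrC; exact: H.
rewrite [leRHS]ger0_norm ?subr_ge0// ler_norml /clamp /Num.max /Num.min.
case: (ltP t h) => ?; case: (ltP s h) => ?;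
  repeat case: ltP => ?; apply/andP; split; lra.
Qed.

(** Picard iteration.  On a time interval of length h with K h <= 1/2 the
    integral operator Phi halves sup-distances, so the iterates of the constant
    curve converge geometrically to a fixed point.  Time is clamped to [-h, h]
    in the definition of Phi, so that all curves live on the whole line and
    their regularity is the single global condition of being B-Lipschitz, which
    is stable under pointwise limits. *)
Lemma ode_bounded (J : finType) (f : (J -> R) -> J -> R) (u0 : J -> R)
    (K B : R) :
  0 <= K -> (forall u j, `|f u j| <= B) ->
  (forall u v (d : R), (forall j, `|u j - v j| <= d) ->
     forall i, `|f u i - f v i| <= K * d) ->
  exists h (u : R -> J -> R), [/\ 0 < h, u 0 = u0 &
    forall t : R, `|t| < h -> forall j,
      `|u t j - u0 j| <= B * `|t| /\ is_derive t 1 (u^~ j) (f (u t) j)].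
Proof.
move=> K0 fB fK.
case: (pselect (exists j : J, True)) => [[j0 _]|noJ]; last first.
  exists 1, (fun=> u0); split => // t _ j; by exfalso; apply: noJ; exists j.
have B0 : 0 <= B by exact: le_trans (normr_ge0 _) (fB u0 j0).
(* K + 1 keeps h positive for K = 0, and also gives h <= 1/2 < 1, within the
   range of the antiderivatives. *)
pose h : R := (2 * (K + 1))^-1.
have h0 : 0 < h by rewrite invr_gt0; lra.
have Kh : K * h <= 2^-1.
  rewrite /h invfM mulrCA ler_piMr ?invr_ge0//.
  by rewrite ler_pdivrMr; lra.
have h1 : h <= 2^-1.
  by rewrite /h invfM ler_piMr ?invr_ge0// invf_le1; lra.
have clt t : `|clamp h t| < 1.
  by apply: (le_lt_trans (clamp_le t (ltW h0))); lra.
have [A HA] : exists A : (R -> R) -> (R -> R), forall g : R -> R, continuous g ->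
    A g 0 = 0 /\ forall t : R, `|t| < 1 -> is_derive t 1 (A g) (g t).
  have : forall g : R -> R, exists G : R -> R, continuous g ->
    G 0 = 0 /\ forall t : R, `|t| < 1 -> is_derive t 1 G (g t).
    move=> g; case: (pselect (continuous g)) => [gc|]; last by exists g.
    by have [G HG] := continuous_antiderivative gc; exists G.
  by move/choice => [A HA]; exists A.
pose good (u : R -> J -> R) :=
  forall s t j, `|u t j - u s j| <= B * `|t - s|.
pose Phi (u : R -> J -> R) t j := u0 j + A (fun s => f (u s) j) (clamp h t).
have goodc u j : good u -> continuous (fun s => f (u s) j).
  move=> gu x; apply/cvgrPdist_le => e e0; near=> z.
  have := fK (u x) (u z) _ (fun i => gu z x i) j.
  move/le_trans; apply.
  have : `|x - z| <= e / (K * B + 1).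
    near: z; apply: cvgr_dist_le; first exact: cvg_id.
    by rewrite divr_gt0//; have := mulr_ge0 K0 B0; lra.
  have KB := mulr_ge0 K0 B0.
  rewrite ler_pdivlMr; last lra.
  by move=> ?; have := normr_ge0 (x - z); rewrite mulrA; nra.
have goodP u : good u -> good (Phi u).
  move=> gu s t j; rewrite /Phi opprD addrACA subrr add0r.
  have [_ HG] := HA _ (goodc u j gu).
  apply: (le_trans (mvt_bound HG _ (clt s) (clt t))) => //.
  by rewrite ler_wpM2l// clamp_lipschitz// ltW.
have contr u v (d : R) : good u -> good v -> (forall t j, `|u t j - v t j| <= d) ->
    forall t j, `|Phi u t j - Phi v t j| <= d / 2.
  move=> gu gv uv t j; rewrite /Phi opprD addrACA subrr add0r.
  have [U0 HU] := HA _ (goodc u j gu); have [V0 HV] := HA _ (goodc v j gv).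
  have d0 : 0 <= d by exact: le_trans (normr_ge0 _) (uv 0 j0).
  have HD : forall t : R, `|t| < 1 -> is_derive t 1
     (fun t => A (fun s => f (u s) j) t - A (fun s => f (v s) j) t)
     (f (u t) j - f (v t) j).
    by move=> x x1; exact: isder_sub (HU x x1) (HV x x1).
  have n0 : `|(0 : R)| < 1 by rewrite normr0.
  have := mvt_bound HD (fun t _ => fK (u t) (v t) d (uv t) j) n0 (clt t).
  rewrite U0 V0 subrr !subr0 => /le_trans; apply.
  have Kc := le_trans (ler_wpM2l K0 (clamp_le t (ltW h0))) Kh.
  by rewrite mulrAC [d / 2]mulrC ler_wpM2r.
pose U k := iter k Phi (fun=> u0).
have gU k : good (U k).
  elim: k => [|k IH] /=; last exact: goodP.
  by move=> s t j; rewrite /= subrr normr0 mulr_ge0.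
have stepU k : forall t j, `|U k.+1 t j - U k t j| <= B / 2 ^+ k.
  elim: k => [|k IH] t j; last first.
    apply: (le_trans (contr _ _ _ (gU _) (gU _) IH t j)).
    rewrite exprS; have := exprn_gt0 k (ltr0Sn R 1); set q := 2 ^+ k => q0.
    by rewrite le_eqVlt; apply/orP; left; apply/eqP; field; rewrite gt_eqF.
  rewrite expr0 divr1 /= /Phi addrAC subrr add0r.
  have [U0 HU] := HA _ (goodc _ j (gU 0)).
  have n0 : `|(0 : R)| < 1 by rewrite normr0.
  have := mvt_bound HU (fun t _ => fB _ j) n0 (clt t).
  rewrite U0 !subr0 => /le_trans; apply.
  by rewrite ler_piMr// ltW.
have [u Hu] : exists u : R -> J -> R,
    forall t j k, `|U k t j - u t j| <= (2 * B) / 2 ^+ k.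
  have : forall tj : R * J, exists l : R,
      forall k, `|U k tj.1 tj.2 - l| <= (2 * B) / 2 ^+ k.
    by case=> t j; apply: geometric_limit => k; exact: stepU.
  by move/choice => [u Hu]; exists (fun t j => u (t, j)) => t j k; exact: (Hu (t, j)).
have gu : good u.
  move=> s t j; apply: (@geometric_slack _ _ (4 * B)) => k.
  have := gU k s t j; move: (Hu t j k) (Hu s j k).
  rewrite (_ : 4 * B / 2 ^+ k = 2 * B / 2 ^+ k + 2 * B / 2 ^+ k); last lra.
  rewrite !ler_norml => /andP[? ?] /andP[? ?] /andP[? ?].
  by apply/andP; split; lra.
have fixu t j : u t j = Phi u t j.
  apply/eqP; rewrite -subr_eq0 -normr_le0.
  apply: (@geometric_slack _ _ (4 * B)) => k; rewrite add0r.
  have a1 := contr _ _ _ (gU k) gu (fun t j => Hu t j k) t j.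
  have a2 := Hu t j k.+1; move: a1 a2.
  rewrite -[Phi (U k) t j]/(U k.+1 t j).
  have := exprn_gt0 k (ltr0Sn R 1); rewrite [2 ^+ k.+1]exprS invfM.
  rewrite -invr_gt0; set q := (2 ^+ k)^-1; move=> q0.
  have := mulr_ge0 B0 (ltW q0).
  rewrite (_ : 2 * B * (2^-1 * q) = B * q); last by field.
  rewrite (_ : 2 * B * q / 2 = B * q); last by field.
  rewrite (_ : 4 * B * q = 4 * (B * q)); last by rewrite mulrA.
  rewrite !ler_norml => ? /andP[? ?] /andP[? ?].
  by apply/andP; split; lra.
exists h, u; split => //.
  apply/funext => j; rewrite fixu /Phi clamp_id ?normr0 ?(ltW h0)//.
  by have [-> _] := HA _ (goodc u j gu); rewrite addr0.
move=> t th j.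
have [A0 HG] := HA _ (goodc u j gu); split.
  have -> : u0 j = u 0 j.
    by rewrite fixu /Phi clamp_id ?normr0 ?(ltW h0)// A0 addr0.
  by have := gu 0 t j; rewrite subr0.
have t1 : `|t| < 1 by apply: (lt_trans th); lra.
have Hd := isder_add (isder_cst (u0 j) t 1) (HG t t1).
rewrite add0r in Hd; apply: near_eq_is_derive Hd.
have : \forall z \near t, `|z| < h.
  have := @cvgr_norm_lt _ _ _ _ _ id t (@cvg_id _ (nbhs t)) h th.
  exact.
apply: filterS => z zh.
by rewrite fixu /Phi clamp_id// ltW.
Unshelve. all: by end_near. Qed.

(** Clamping the state to the box of radius r makes the vector field globally
    Lipschitz and bounded; for short times the solution stays in the box, where
    the clamped field is the original one. *)
Lemma ode_exists (J : finType) (f : (J -> R) -> J -> R) (u0 : J -> R)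
    (K r : R) : 0 < r -> 0 <= K ->
  (forall u v (d : R), (forall j, `|u j - u0 j| <= r) ->
     (forall j, `|v j - u0 j| <= r) -> (forall j, `|u j - v j| <= d) ->
     forall i, `|f u i - f v i| <= K * d) ->
  exists h (u : R -> J -> R), [/\ 0 < h, u 0 = u0 &
    forall t : R, `|t| < h -> forall j,
      `|u t j - u0 j| <= r /\ is_derive t 1 (u^~ j) (f (u t) j)].
Proof.
move=> r0 K0 fK.
pose cl (u : J -> R) j := u0 j + clamp r (u j - u0 j).
have clr u j : `|cl u j - u0 j| <= r.
  by rewrite /cl addrAC subrr add0r clamp_le// ltW.
have cll u v d : (forall j, `|u j - v j| <= d) ->
    forall j, `|cl u j - cl v j| <= d.
  move=> uv j; apply: le_trans (uv j).
  rewrite /cl opprD addrACA subrr add0r.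
  apply: (le_trans (clamp_lipschitz _ _ (ltW r0))).
  by rewrite opprB addrA subrK.
pose B := K * r + \sum_j `|f u0 j|.
have u0r j : `|u0 j - u0 j| <= r by rewrite subrr normr0 ltW.
have fB u j : `|f (cl u) j| <= B.
  rewrite -[f (cl u) j](subrK (f u0 j)).
  apply: (le_trans (ler_normD _ _)); apply: lerD.
    exact: fK.
  by rewrite (bigD1 j)//= lerDl sumr_ge0.
have [h [u [h0 u00 Hu]]] := ode_bounded u0 K0 fB
  (fun u v d uv => fK _ _ _ (clr u) (clr v) (cll _ _ _ uv)).
(* The solution moves at speed at most B, hence stays in the box up to time
   r / B'. *)
pose B' := `|B| + 1.
have B'0 : 0 < B' by rewrite /B'; have := normr_ge0 B; lra.
exists (Num.min h (r / B')), u; split=> //.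
  by rewrite lt_min h0 divr_gt0.
move=> t; rewrite lt_min => /andP[th tr] j.
have [_ Hd] := Hu t th j.
have near_u i : `|u t i - u0 i| <= r.
  apply: (le_trans (Hu t th i).1).
  move: tr; rewrite ltr_pdivlMr// /B' => tr.
  by have := normr_ge0 t; have := ler_norm B; nra.
split=> //; apply: is_derive_eq Hd _; congr (f _ j).
by apply/funext => i; rewrite /cl clamp_id// addrC subrK.
Qed.

End Ode.

(** * Coordinates and local Lipschitz bounds *)
Section Coordinates.
Context {R : realType} {n : nat}.
Implicit Types (x y v : 'rV[R]_n) (f : 'rV[R]_n -> R).

Lemma norm_row_le (v : 'rV[R]_n) (e : R) : 0 <= e ->
  (forall i, `|v 0 i| <= e) -> `|v| <= e.
Proof.
move=> e0 H; rewrite /Num.Def.normr /= mx_normrE (bigmax_le _ e0)//= => -[i j] _.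
by rewrite ord1.
Qed.

Lemma derive_sum_pd f x v : differentiable f x ->
  'D_v f x = \sum_i v 0 i * pd i f x.
Proof.
move=> df; rewrite deriveE// {1}[v]row_sum_delta linear_sum /=.
by apply: eq_bigr => i _; rewrite linearZ /= /pd deriveE.
Qed.

Lemma smooth_on_differentiable (A : set 'rV[R]_n) f x :
  smooth_on A f -> A x -> differentiable f x.
Proof. by move=> H Ax; exact: (H [::]). Qed.

Lemma smooth_on_differentiable_pd (A : set 'rV[R]_n) f x i :
  smooth_on A f -> A x -> differentiable (pd i f) x.
Proof. by move=> H Ax; exact: (H [:: evec i]). Qed.

Lemma isder_coord i (x v : 'rV[R]_n) : is_derive x v (fun z => z 0 i) (v 0 i).
Proof.
have := differentiable_coord x 0 i => d.
split; first exact: diff_derivable.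
apply/lim_near_cst => //=; near=> h.
rewrite /= !mxE addrK /GRing.scale /= mulrA mulVf ?mul1r//.
by near: h; exact: nbhs_dnbhs_neq.
Unshelve. all: by end_near. Qed.

Lemma pd_near f g (x : 'rV[R]_n) i : (\forall z \near x, f z = g z) ->
  pd i f x = pd i g x.
Proof. exact: near_eq_derive. Qed.

Lemma pd_isder f (x : 'rV[R]_n) i (df : R) : is_derive x (evec i) f df -> pd i f x = df.
Proof. by case. Qed.

End Coordinates.

Section Lipschitz.
Context {R : realType} {J : finType} (u0 : J -> R).
Implicit Types (p q : (J -> R) -> R) (u v : J -> R).

Definition box (r : R) u := forall j, `|u j - u0 j| <= r.

(** Distances are measured by a bound d on all coordinates, in the form in which
    the Picard iteration uses them. *)
Definition loclip p := exists r K : R, [/\ 0 < r, 0 <= K &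
  forall u v (d : R), box r u -> box r v -> (forall j, `|u j - v j| <= d) ->
    `|p u - p v| <= K * d].

Lemma box_le (r r' : R) u : r <= r' -> box r u -> box r' u.
Proof. by move=> rr H j; exact: le_trans (H j) rr. Qed.

Lemma loclip_cst (c : R) : loclip (fun=> c).
Proof. by exists 1, 0; split => // u v d _ _ _; rewrite subrr normr0 mul0r. Qed.

Lemma loclip_proj j : loclip (fun u => u j).
Proof. by exists 1, 1; split => // u v d _ _ H; rewrite mul1r. Qed.

Lemma loclip_add p q : loclip p -> loclip q -> loclip (fun u => p u + q u).
Proof.
move=> [r [K [r0 K0 H]]] [r' [K' [r'0 K'0 H']]].
exists (Num.min r r'), (K + K'); split; rewrite ?addr_ge0 ?lt_min ?r0//.
move=> u v d bu bv uv; rewrite mulrDl opprD addrACA.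
apply: (le_trans (ler_normD _ _)); apply: lerD; [apply: H|apply: H'] => //.
all: by apply: box_le; last eassumption; rewrite ge_min lexx ?orbT.
Qed.

Lemma loclip_bounded p : loclip p -> exists r C : R, [/\ 0 < r, 0 <= C &
  forall u, box r u -> `|p u| <= C].
Proof.
move=> [r [K [r0 K0 H]]]; exists r, (K * r + `|p u0|); split => //.
  by rewrite addr_ge0 ?mulr_ge0// ltW.
move=> u bu; rewrite -{1}[p u](subrK (p u0)).
apply: (le_trans (ler_normD _ _)); rewrite lerD2r; apply: H => //.
by move=> j; rewrite subrr normr0 ltW.
Qed.

Lemma loclip_mul p q : loclip p -> loclip q -> loclip (fun u => p u * q u).
Proof.
move=> hp hq.
have [s [C [s0 C0 Hp]]] := loclip_bounded hp.
have [s' [C' [s'0 C'0 Hq]]] := loclip_bounded hq.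
have [r [K [r0 K0 H]]] := hp; have [r' [K' [r'0 K'0 H']]] := hq.
exists (Num.min (Num.min r r') (Num.min s s')), (K * C' + C * K'); split.
- by rewrite !lt_min r0 r'0 s0.
- by rewrite addr_ge0 ?mulr_ge0.
move=> u v d bu bv uv.
have lr : Num.min (Num.min r r') (Num.min s s') <= r by rewrite !ge_min lexx.
have lr' : Num.min (Num.min r r') (Num.min s s') <= r'
  by rewrite !ge_min lexx ?orbT.
have ls : Num.min (Num.min r r') (Num.min s s') <= s
  by rewrite !ge_min lexx ?orbT.
have ls' : Num.min (Num.min r r') (Num.min s s') <= s'
  by rewrite !ge_min lexx ?orbT.
have -> : p u * q u - p v * q v = (p u - p v) * q u + p v * (q u - q v) by ring.
rewrite [leRHS]mulrDl; apply: (le_trans (ler_normD _ _)); rewrite !normrM.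
have h1 := H u v d (box_le lr bu) (box_le lr bv) uv.
have h2 := H' u v d (box_le lr' bu) (box_le lr' bv) uv.
have h3 := Hq u (box_le ls' bu); have h4 := Hp v (box_le ls bv).
apply: lerD.
  by rewrite mulrAC; apply: ler_pM.
by rewrite -mulrA; apply: ler_pM.
Qed.

Lemma loclip_sum (I : Type) (s : seq I) (P : pred I) (F : I -> (J -> R) -> R) :
  (forall i, loclip (F i)) -> loclip (fun u => \sum_(i <- s | P i) F i u).
Proof.
move=> H; elim: s => [|i s IH].
  rewrite (_ : (fun _ => _) = fun=> 0); first exact: loclip_cst.
  by apply/funext => z; rewrite big_nil.
rewrite (_ : (fun _ => _) =
  fun z => if P i then F i z + \sum_(j <- s | P j) F j z
           else \sum_(j <- s | P j) F j z); last first.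
  by apply/funext => z; rewrite big_cons.
by case: (P i) => //; exact: loclip_add.
Qed.

(** The element j0 excludes an empty set of coordinates, for which d could be
    negative. *)
Lemma loclip_family (j0 : J) (I : finType) (F : I -> (J -> R) -> R) :
  (forall i, loclip (F i)) -> exists r K : R, [/\ 0 < r, 0 <= K &
  forall u v (d : R), box r u -> box r v -> (forall j, `|u j - v j| <= d) ->
    forall i, `|F i u - F i v| <= K * d].
Proof.
move=> H.
suff [r [K [r0 K0 HH]]] : exists r K : R, [/\ 0 < r, 0 <= K &
  forall u v (d : R), box r u -> box r v -> (forall j, `|u j - v j| <= d) ->
    forall i, i \in enum I -> `|F i u - F i v| <= K * d].
  by exists r, K; split => // u v d bu bv uv i; apply: HH => //; rewrite mem_enum.
elim: (enum I) => [|i s [r [K [r0 K0 IH]]]]; first by exists 1, 0; split.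
have [r' [K' [r'0 K'0 Hi]]] := H i.
exists (Num.min r r'), (K + K'); split; rewrite ?addr_ge0 ?lt_min ?r0//.
move=> u v d bu bv uv k.
have lr : Num.min r r' <= r by rewrite ge_min lexx.
have lr' : Num.min r r' <= r' by rewrite ge_min lexx orbT.
have d0 : 0 <= d by exact: le_trans (normr_ge0 _) (uv j0).
rewrite inE => /predU1P[->|ks].
  apply: (le_trans (Hi _ _ _ (box_le lr' bu) (box_le lr' bv) uv)).
  by rewrite ler_wpM2r// lerDr.
apply: (le_trans (IH _ _ _ (box_le lr bu) (box_le lr bv) uv _ ks)).
by rewrite ler_wpM2r// lerDl.
Qed.

End Lipschitz.

Section LipschitzC1.
Context {R : realType} {n : nat} {J : finType} (c : 'I_n -> J) (u0 : J -> R).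

(** The mean value theorem on the segment between two states in the box, along
    which the derivative is the sum of the partial derivatives weighted by the
    coordinate differences. *)
Lemma loclip_C1 (U : set 'rV[R]_n) (h : 'rV[R]_n -> R) :
  open U -> U (\row_i u0 (c i)) ->
  (forall x, U x -> differentiable h x) ->
  (forall i x, U x -> {for x, continuous (pd i h)}) ->
  loclip u0 (fun u => h (\row_i u (c i))).
Proof.
set x0 := \row_i _ => oU Ux0 dh ch.
pose C := \sum_i (`|pd i h x0| + 1).
have C0 : 0 <= C by rewrite sumr_ge0// => i _; rewrite addr_ge0.
have [r r0 Hr] : exists2 r : R, 0 < r & forall z, `|z - x0| < r ->
    U z /\ forall i, `|pd i h z| <= `|pd i h x0| + 1.
  have : \forall z \near x0, U z /\ forall i, `|pd i h z| <= `|pd i h x0| + 1.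
    have hU : \forall z \near x0, U z by exact: open_nbhs_nbhs.
    have hp : \forall z \near x0, forall i, `|pd i h z| <= `|pd i h x0| + 1.
      apply: (@filter_forall _ _
        (fun i z => `|pd i h z| <= `|pd i h x0| + 1) (nbhs x0)) => i.
      by apply: (cvgr_norm_le _ (ch i x0 Ux0)); rewrite ltrDl.
    by apply: filterS2 hU hp => z; exact: conj.
  move=> /nbhs_ballP[r /= r0 Hr]; exists r => // z zr.
  by apply: Hr; rewrite -ball_normE /ball_ /= distrC.
exists (r / 2), C; split => //; first by rewrite divr_gt0.
move=> u v d bu bv uv.
set x := \row_i u (c i); set z := \row_i v (c i).
have xr : `|x - x0| <= r / 2.
  by apply: norm_row_le => [|i]; [rewrite divr_ge0// ltW|rewrite !mxE; exact: bu].
have zr : `|z - x0| <= r / 2.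
  by apply: norm_row_le => [|i]; [rewrite divr_ge0// ltW|rewrite !mxE; exact: bv].
have seg (t : R) : 0 <= t <= 1 -> `|(t *: (x - z) + z) - x0| < r.
  move=> /andP[t0 t1].
  have -> : (t *: (x - z) + z) - x0 = t *: (x - x0) + (1 - t) *: (z - x0).
    by apply/rowP => i; rewrite !mxE; ring.
  apply: (le_lt_trans (ler_normD _ _)); rewrite !normrZ !ger0_norm ?subr_ge0//.
  have h1 := ler_wpM2l t0 xr.
  have t1' : 0 <= 1 - t by rewrite subr_ge0.
  have h2 := ler_wpM2l t1' zr.
  by lra.
have Hd (t : R) : 0 <= t <= 1 ->
    is_derive t 1 (fun t => h (t *: (x - z) + z)) ('D_(x - z) h (t *: (x - z) + z)).
  move=> /seg /Hr [/dh dt _].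
  have := differentiable_isder (x - z) dt.
  move=> /is_derive_lineP H; apply/is_derive_lineP.
  move: H; set f1 := fun _ => _; set f2 := fun _ => _.
  suff -> : f1 = f2 by [].
  by apply/funext => k; rewrite /f1 /f2 [k *: 1]mulr1 addrA -scalerDl.
have inI (t : R) : t \in `[0, 1]%R -> 0 <= t <= 1 by rewrite in_itv.
have inIo (t : R) : t \in `]0, 1[%R -> 0 <= t <= 1.
  by move=> tI; apply: inI; exact: subset_itv_oo_cc.
have [t tI E] := @MVT R _ _ 0 1 ltr01
   (fun t tI => Hd t (inIo t tI))
   (derivable_within_continuous
       (fun t tI => @ex_derive _ _ _ _ _ _ _ (Hd t (inI t tI)))).
have tI' := inIo t tI.
move: E; rewrite scale1r scale0r add0r subrK subr0 mulr1 => ->.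
have [/dh dt Hp] := Hr _ (seg t tI').
rewrite derive_sum_pd// /C mulr_suml; apply: (le_trans (ler_norm_sum _ _ _)).
apply: ler_sum => i _; rewrite normrM mulrC !mxE.
by apply: ler_pM.
Qed.

End LipschitzC1.

(** * Differentiation of the inverse of a matrix *)
Section InverseMatrix.
Context {R : realType} {V : normedModType R}.
Implicit Types (x v : V).

Lemma differentiable_bigsum (I : Type) (s : seq I) (P : pred I) (F : I -> V -> R) x :
  (forall i, differentiable (F i) x) ->
  differentiable (fun z => \sum_(i <- s | P i) F i z) x.
Proof.
move=> H; elim: s => [|i s IH].
  rewrite (_ : (fun _ => _) = cst 0); first exact: differentiable_cst.
  by apply/funext => z; rewrite big_nil.
rewrite (_ : (fun _ => _) =
  fun z => if P i then F i z + \sum_(j <- s | P j) F j z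
           else \sum_(j <- s | P j) F j z); last first.
  by apply/funext => z; rewrite big_cons.
by case: (P i) => //; exact: differentiableD.
Qed.

Lemma differentiable_bigprod (I : Type) (s : seq I) (P : pred I) (F : I -> V -> R) x :
  (forall i, differentiable (F i) x) ->
  differentiable (fun z => \prod_(i <- s | P i) F i z) x.
Proof.
move=> H; elim: s => [|i s IH].
  rewrite (_ : (fun _ => _) = cst 1); first exact: differentiable_cst.
  by apply/funext => z; rewrite big_nil.
rewrite (_ : (fun _ => _) =
  fun z => if P i then F i z * \prod_(j <- s | P j) F j z
           else \prod_(j <- s | P j) F j z); last first.
  by apply/funext => z; rewrite big_cons.
by case: (P i) => //; exact: differentiableM.
Qed.

Lemma differentiable_det m (B : V -> 'M[R]_m) x :
  (forall i j, differentiable (fun z => B z i j) x) ->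
  differentiable (fun z => \det (B z)) x.
Proof.
move=> H; rewrite /determinant; apply: differentiable_bigsum => s.
apply: differentiableM; first exact: differentiable_cst.
exact: differentiable_bigprod.
Qed.

(** An entry of the inverse given by Cramer's rule.  It agrees with [invmx] on
    invertible matrices and, unlike [invmx], involves no test of invertibility,
    so that it is differentiable by the rules for sums, products and inverses.
*)
Definition inv_entry m (A : 'M[R]_m) i j : R := (\det A)^-1 * \adj A i j.

Lemma inv_entryE m (A : 'M[R]_m) i j : A \in unitmx ->
  inv_entry A i j = invmx A i j.
Proof. by move=> Au; rewrite /inv_entry /invmx Au !mxE. Qed.

Lemma differentiable_inv_entry m (B : V -> 'M[R]_m) x i j :
  B x \in unitmx -> (forall i j, differentiable (fun z => B z i j) x) ->
  differentiable (fun z => inv_entry (B z) i j) x.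
Proof.
move=> Bu H; rewrite /inv_entry; apply: differentiableM.
  apply: differentiableV; first exact: differentiable_det.
  by rewrite -unitfE -unitmxE.
rewrite (_ : (fun _ => _) = fun z => cofactor (B z) j i); last first.
  by apply/funext => z; rewrite mxE.
rewrite /cofactor; apply: differentiableM; first exact: differentiable_cst.
apply: differentiable_det => p q.
rewrite (_ : (fun _ => _) = fun z => B z (lift j p) (lift i q)) //.
by apply/funext => z; rewrite !mxE.
Qed.

(** Differentiate B B^-1 = 1. *)
Lemma isder_inv_entry m (B : V -> 'M[R]_m) x v i j :
  (\forall z \near x, B z \in unitmx) ->
  (forall i j, differentiable (fun z => B z i j) x) ->
  is_derive x v (fun z => inv_entry (B z) i j)
    ((- (invmx (B x) *m (\matrix_(i, j) 'D_v (fun z => B z i j) x)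
         *m invmx (B x))) i j).
Proof.
move=> Bu H; have Bx := nbhs_singleton Bu.
have dI p q := differentiable_isder v (differentiable_inv_entry p q Bx H).
apply: is_derive_eq (dI i j) _.
set dB := \matrix_(i, j) _.
pose dJ := \matrix_(p, q) 'D_v (fun z => inv_entry (B z) p q) x.
suff -> : - (invmx (B x) *m dB *m invmx (B x)) = dJ by rewrite mxE.
have E : dB *m invmx (B x) + B x *m dJ = 0.
  apply/matrixP => p q; rewrite !mxE -big_split /=.
  have h1 : is_derive x v (fun z => \sum_r B z p r * inv_entry (B z) r q)
     (\sum_r ('D_v (fun z => B z p r) x * inv_entry (B x) r q
              + B x p r * 'D_v (fun z => inv_entry (B z) r q) x)).
    by apply: isder_sum => r; apply: isder_mul; first exact: differentiable_isder.
  have h2 : is_derive x v (fun z => \sum_r B z p r * inv_entry (B z) r q) 0.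
    apply: (near_eq_is_derive _ (isder_cst ((p == q)%:R : R) x v)).
    apply: filterS Bu => z zu.
    have := congr1 (fun M : 'M[R]_m => M p q) (mulmxV zu); rewrite !mxE => <-.
    by apply: eq_bigr => r _; rewrite inv_entryE.
  have [_ e1] := h1; have [_ e2] := h2; apply: (etrans _ e2); rewrite e1.
  by apply: eq_bigr => r _; rewrite !mxE inv_entryE.
have := congr1 (mulmx (invmx (B x))) E.
rewrite mulmxDr mulmx0 !mulmxA mulVmx// mul1mx => /eqP.
by rewrite addrC addr_eq0 => /eqP ->.
Qed.

Lemma isder_invmx m (B : V -> 'M[R]_m) x v i j :
  (\forall z \near x, B z \in unitmx) ->
  (forall i j, differentiable (fun z => B z i j) x) ->
  is_derive x v (fun z => invmx (B z) i j)
    ((- (invmx (B x) *m (\matrix_(i, j) 'D_v (fun z => B z i j) x)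
         *m invmx (B x))) i j).
Proof.
move=> Bu H; apply: near_eq_is_derive (isder_inv_entry v i j Bu H).
by apply: filterS Bu => z zu; rewrite inv_entryE.
Qed.

End InverseMatrix.

(** * Hamel's equations and radial sprays *)
Section Rapcsak.
Context {R : realType} {n : nat}.
Implicit Types (x y v w : 'rV[R]_n).

Lemma pdy_sqfun (F : 'rV[R]_n -> 'rV[R]_n -> R) x y i (d : R) :
  is_derive y (evec i) (F x) d -> pdy i (sqfun F) x y = 2 * F x y * d.
Proof.
move=> H; rewrite /pdy; apply: pd_isder.
have := isder_mul H H; rewrite (_ : _ + _ = 2 * F x y * d); last ring.
by apply: near_eq_is_derive; near=> z; rewrite /sqfun expr2.
Unshelve. all: by end_near. Qed.

Lemma pdx_sqfun (F : 'rV[R]_n -> 'rV[R]_n -> R) x y k (d : R) :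
  is_derive x (evec k) (F^~ y) d -> pdx k (sqfun F) x y = 2 * F x y * d.
Proof.
move=> H; rewrite /pdx; apply: pd_isder.
have := isder_mul H H; rewrite (_ : _ + _ = 2 * F x y * d); last ring.
by apply: near_eq_is_derive; near=> z; rewrite /sqfun expr2.
Unshelve. all: by end_near. Qed.

(** The families Fx, Fy, Fxy, Fyy stand for the partial derivatives of F.  The
    identities F_j y^j = F and F_ij y^j = 0 express homogeneity of degree one in
    y, and they give g_ij y^j = F F_i.  Hamel's equations turn
    (F^2)_{x^k y^l} y^k - (F^2)_{x^l} into 2 (F_{x^k} y^k) F_l, which is
    therefore proportional to g_lj y^j; applying g^-1 leaves a multiple of y. *)
Lemma radial_spray_of_hamel (F : 'rV[R]_n -> 'rV[R]_n -> R) x y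
    (Fx Fy : 'I_n -> 'rV[R]_n -> R) (Fxy Fyy : 'I_n -> 'I_n -> R) :
  (forall k, \forall z \near y, is_derive x (evec k) (F^~ z) (Fx k z)) ->
  (forall i, \forall z \near y, is_derive z (evec i) (F x) (Fy i z)) ->
  (forall k l, is_derive y (evec l) (Fx k) (Fxy k l)) ->
  (forall i j, is_derive y (evec j) (Fy i) (Fyy i j)) ->
  F x y != 0 -> fundamental_tensor F x y \in unitmx ->
  \sum_j Fy j y * y 0 j = F x y ->
  (forall i, \sum_j Fyy i j * y 0 j = 0) ->
  (forall l, \sum_k Fxy k l * y 0 k = Fx l y) ->
  exists P : R, spray F x y = P *: y.
Proof.
move=> HFx HFy HFxy HFyy F0 gU E1 E1' E2.
have Fyy_near i : \forall z \near y, 2 * F x z * Fy i z = pdy i (sqfun F) x z.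
  by apply: filterS (HFy i) => z Hz; rewrite (pdy_sqfun Hz).
have Fxy_near k : \forall z \near y, 2 * F x z * Fx k z = pdx k (sqfun F) x z.
  by apply: filterS (HFx k) => z Hz; rewrite (pdx_sqfun Hz).
have HF j : is_derive y (evec j) (F x) (Fy j y) by exact: nbhs_singleton (HFy j).
have gE i j : fundamental_tensor F x y i j = Fy j y * Fy i y + F x y * Fyy i j.
  rewrite mxE /pdy.
  have Hd := isder_mul (isder_scale 2 (HF j)) (HFyy i j).
  by rewrite (pd_isder (near_eq_is_derive (Fyy_near i) Hd)); field.
have LxyE k l : pdy l (pdx k (sqfun F)) x y =
    2 * Fy l y * Fx k y + 2 * F x y * Fxy k l.
  rewrite /pdy.
  have H := isder_mul (isder_scale 2 (HF l)) (HFxy k l).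
  exact: (pd_isder (near_eq_is_derive (Fxy_near k) H)).
pose D := \sum_k Fx k y * y 0 k.
have gy : fundamental_tensor F x y *m y^T = \col_i (F x y * Fy i y).
  apply/colP => i; rewrite !mxE.
  transitivity (\sum_j (Fy i y * (Fy j y * y 0 j) + F x y * (Fyy i j * y 0 j))).
    by apply: eq_bigr => j _; rewrite [y^T _ _]mxE gE; ring.
  by rewrite big_split /= -!mulr_sumr E1 E1' mulr0 addr0 mulrC.
have key l : (\sum_k pdy l (pdx k (sqfun F)) x y * y 0 k) - pdx l (sqfun F) x y
    = 2 * D * Fy l y.
  rewrite (pdx_sqfun (nbhs_singleton (HFx l))).
  transitivity (\sum_k (2 * Fy l y * (Fx k y * y 0 k)
      + 2 * F x y * (Fxy k l * y 0 k)) - 2 * F x y * Fx l y).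
    by congr (_ - _); apply: eq_bigr => k _; rewrite LxyE; ring.
  by rewrite big_split /= -!mulr_sumr E2 /D; ring.
exists (D / (2 * F x y)).
have ginv : invmx (fundamental_tensor F x y) *m \col_i (F x y * Fy i y) = y^T.
  by rewrite -gy mulKmx.
apply/rowP => i; rewrite !mxE.
under eq_bigr do rewrite key.
have := congr1 (fun M : 'M[R]_(n, 1) => M i 0) ginv; rewrite !mxE => <-.
rewrite [LHS]mulr_sumr [RHS]mulr_sumr; apply: eq_bigr => l _.
rewrite [(\col__ _) _ _]mxE.
by field.
Qed.

End Rapcsak.

(** * Quadratic and linear forms in y *)
Section QuadraticForm.
Context {R : realType} {n : nat}.
Implicit Types (x y v w : 'rV[R]_n) (S : 'M[R]_n).

Definition bil S v w : R := \sum_i \sum_j S i j * v 0 i * w 0 j.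
Definition dot (b v : 'rV[R]_n) : R := \sum_i b 0 i * v 0 i.

Lemma bilE S v w : bil S v w = (v *m S *m w^T) 0 0.
Proof.
rewrite !mxE /bil exchange_big /=; apply: eq_bigr => j _.
rewrite !mxE mulr_suml; apply: eq_bigr => i _; ring.
Qed.

Lemma dotE b v : dot b v = (b *m v^T) 0 0.
Proof. by rewrite !mxE /dot; apply: eq_bigr => j _; rewrite mxE. Qed.

Lemma bil_sym S v w : S^T = S -> bil S v w = bil S w v.
Proof.
move=> Ss; rewrite /bil exchange_big /=; apply: eq_bigr => j _.
by apply: eq_bigr => i _; rewrite -{1}Ss mxE; ring.
Qed.

Lemma bil_evecr S v l : bil S v (evec l) = \sum_i S i l * v 0 i.
Proof.
rewrite /bil; apply: eq_bigr => i _; rewrite (bigD1 l)//= big1 ?addr0.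
  by rewrite !mxE !eqxx mulr1.
by move=> j jl; rewrite !mxE eqxx (negbTE jl) mulr0.
Qed.

Lemma bil_evecl S v l : bil S (evec l) v = \sum_j S l j * v 0 j.
Proof.
rewrite /bil (bigD1 l)//= [X in _ + X]big1 ?addr0.
  by apply: eq_bigr => j _; rewrite !mxE !eqxx mulr1.
move=> i il; rewrite big1// => j _; rewrite !mxE eqxx (negbTE il).
by rewrite mulr0 mul0r.
Qed.

Lemma dot_evec b l : dot b (evec l) = b 0 l.
Proof.
rewrite /dot (bigD1 l)//= big1 ?addr0; first by rewrite !mxE !eqxx mulr1.
by move=> j jl; rewrite !mxE eqxx (negbTE jl) mulr0.
Qed.

Lemma bil_sumr S v y : \sum_l bil S v (evec l) * y 0 l = bil S v y.
Proof.
rewrite [RHS]/bil [RHS]exchange_big /=; apply: eq_bigr => l _.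
by rewrite bil_evecr mulr_suml.
Qed.

Lemma dot_sum b y : \sum_l dot b (evec l) * y 0 l = dot b y.
Proof. by apply: eq_bigr => l _; rewrite dot_evec. Qed.

Lemma isder_quad S y v : S^T = S ->
  is_derive y v (fun z => bil S z z) (2 * bil S y v).
Proof.
move=> Ss.
have H : is_derive y v (fun z => bil S z z)
   (\sum_i \sum_j (S i j * v 0 i * y 0 j + S i j * y 0 i * v 0 j)).
  apply: isder_sum => i; apply: isder_sum => j; apply: isder_mul.
    by apply: isder_scale; exact: isder_coord.
  exact: isder_coord.
apply: is_derive_eq H _.
under eq_bigr do rewrite big_split /=.
by rewrite big_split /= -!/(bil S _ _) (bil_sym v y Ss) mulr2n mulrDl mul1r.
Qed.

Lemma isder_bil S y v w :
  is_derive y v (fun z => bil S z w) (bil S v w).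
Proof.
apply: isder_sum => i; apply: isder_sum => j.
have H := isder_mul (isder_scale (S i j) (isder_coord i y v)) (isder_cst (w 0 j) y v).
by apply: is_derive_eq H _; rewrite mulr0 addr0.
Qed.

Lemma isder_dot b y v : is_derive y v (dot b) (dot b v).
Proof. by apply: isder_sum => i; apply: isder_scale; exact: isder_coord. Qed.

End QuadraticForm.

(** * Hamel's equations for alpha phi(b^2, beta / alpha) *)
Section Lincomb.
Context {R : realType} {n : nat}.
Lemma sum_lincomb5 (c1 c2 c3 c4 c5 : R) (f1 f2 f3 f4 f5 y : 'I_n -> R) :
  \sum_k (c1 * f1 k + c2 * f2 k + c3 * f3 k + c4 * f4 k + c5 * f5 k) * y k =
  c1 * (\sum_k f1 k * y k) + c2 * (\sum_k f2 k * y k) + c3 * (\sum_k f3 k * y k)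
  + c4 * (\sum_k f4 k * y k) + c5 * (\sum_k f5 k * y k).
Proof.
rewrite !mulr_sumr -!big_split /=; apply: eq_bigr => k _; ring.
Qed.

Lemma sum_lincomb3 (c1 c2 c3 : R) (f1 f2 f3 y : 'I_n -> R) :
  \sum_k (c1 * f1 k + c2 * f2 k + c3 * f3 k) * y k =
  c1 * (\sum_k f1 k * y k) + c2 * (\sum_k f2 k * y k) + c3 * (\sum_k f3 k * y k).
Proof.
rewrite !mulr_sumr -!big_split /=; apply: eq_bigr => k _; ring.
Qed.
End Lincomb.

Section AlphaBeta.
Context {R : realType} {n : nat}.
Implicit Types (x y v w z : 'rV[R]_n).

Lemma near_neq0 y : y != 0 -> \forall z \near y, z != 0.
Proof.
exact: (@cvgr_neq0 _ _ _ _ _ id y (@cvg_id _ (nbhs y))).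
Qed.

Variables (A : 'rV[R]_n -> 'M[R]_n) (b : 'rV[R]_n -> 'rV[R]_n).
Variables (T : 'rV[R]_n -> R) (phi : R -> R -> R) (W : set (R * R)).
Variable x : 'rV[R]_n.
Hypothesis Asym : (A x)^T = A x.
Hypothesis Apos : forall z, z != 0 -> 0 < bil (A x) z z.
Hypothesis smW : smooth_on W (fun p => phi p.1 p.2).

Local Notation S := (A x).
Let al z := Num.sqrt (bil S z z).
Let s z := dot (b x) z / al z.
Hypothesis inW : forall z, z != 0 -> W (T x, s z).
Variables (dA : 'I_n -> 'M[R]_n) (db : 'I_n -> 'rV[R]_n) (dT : 'I_n -> R).
Hypothesis HdA : forall k i j, is_derive x (evec k) (fun z => A z i j) (dA k i j).
Hypothesis dAsym : forall k, (dA k)^T = dA k.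
Hypothesis Hdb : forall k i, is_derive x (evec k) (fun z => b z 0 i) (db k 0 i).
Hypothesis HdT : forall k, is_derive x (evec k) T (dT k).

(* F = al * phi(T, s); T stands for b^2 and x' varies near x. *)
Let F x' z := Num.sqrt (bil (A x') z z) *
              phi (T x') (dot (b x') z / Num.sqrt (bil (A x') z z)).

Let al0 z : z != 0 -> 0 < al z.
Proof. by move=> z0; rewrite sqrtr_gt0; exact: Apos. Qed.

Let al2 z : z != 0 -> bil S z z = al z ^+ 2.
Proof. by move=> z0; rewrite sqr_sqrtr// ltW// Apos. Qed.

Let isder_al z w : z != 0 -> is_derive z w al (bil S z w / al z).
Proof.
move=> z0; have H := isder_sqrt (f := fun z => bil S z z) (Apos z0) (isder_quad z w Asym).
apply: is_derive_eq H _; rewrite -/(al z); field.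
by rewrite gt_eqF// al0.
Qed.

Let isder_s z w : z != 0 ->
  is_derive z w s ((dot (b x) w - s z * (bil S z w / al z)) / al z).
Proof.
move=> z0; have a0 : al z != 0 by rewrite gt_eqF// al0.
have H := isder_mul (isder_dot (b x) z w) (isder_inv a0 (isder_al w z0)).
by apply: is_derive_eq H _; rewrite /s; field.
Qed.

Let ds z w := (dot (b x) w - s z * (bil S z w / al z)) / al z.
(* The digits are the indices of the partial derivatives of phi. *)
Let p0 z := phi (T x) (s z).
Let p1 z := d1 phi (T x) (s z).
Let p2 z := d2 phi (T x) (s z).
Let p12 z := d2 (d1 phi) (T x) (s z).
Let p22 z := d2 (d2 phi) (T x) (s z).

Let isder_p0 z w : z != 0 -> is_derive z w p0 (p2 z * ds z w).
Proof.
move=> z0; have [_ H _ _] := smooth_phi_derivable smW (inW z0).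
exact: isder_comp H (isder_s w z0).
Qed.

Let isder_p1 z w : z != 0 -> is_derive z w p1 (p12 z * ds z w).
Proof.
move=> z0; have [_ _ H _] := smooth_phi_derivable smW (inW z0).
exact: isder_comp H (isder_s w z0).
Qed.

Let isder_p2 z w : z != 0 -> is_derive z w p2 (p22 z * ds z w).
Proof.
move=> z0; have [_ _ _ H] := smooth_phi_derivable smW (inW z0).
exact: isder_comp H (isder_s w z0).
Qed.

(* phi - s phi_2 is the derivative of u phi(t, w / u) in u; in its own
   derivative along y the terms with phi_2 cancel. *)
Let pe z := p0 z - s z * p2 z.

Let isder_pe z w : z != 0 -> is_derive z w pe (- (s z * p22 z * ds z w)).
Proof.
move=> z0.
have H := isder_sub (isder_p0 w z0) (isder_mul (isder_s w z0) (isder_p2 w z0)).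
by apply: is_derive_eq H _; rewrite -/(ds z w); ring.
Qed.

Let Fy i z := pe z * (bil S z (evec i) / al z) + p2 z * dot (b x) (evec i).

Let isder_F_y z w : z != 0 ->
  is_derive z w (F x) (pe z * (bil S z w / al z) + p2 z * dot (b x) w).
Proof.
move=> z0; have a0 : al z != 0 by rewrite gt_eqF// al0.
have H := isder_mul (isder_al w z0) (isder_p0 w z0).
by apply: is_derive_eq H _; rewrite /ds /pe; field.
Qed.

Let Fyy y i j :=
  (- (s y * p22 y * ds y (evec j))) * (bil S y (evec i) / al y)
  + pe y * (bil S (evec j) (evec i) / al y
            - bil S y (evec i) * bil S y (evec j) / al y ^+ 3)
  + p22 y * ds y (evec j) * dot (b x) (evec i).

Let isder_Fyy y i j : y != 0 -> is_derive y (evec j) (Fy i) (Fyy y i j).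
Proof.
move=> y0; have a0 : al y != 0 by rewrite gt_eqF// al0.
have Hq := isder_mul (isder_bil S y (evec j) (evec i))
                   (isder_inv a0 (isder_al (evec j) y0)).
have H := isder_add (isder_mul (isder_pe (evec j) y0) Hq)
            (isder_mul (isder_p2 (evec j) y0) (isder_cst (dot (b x) (evec i)) y (evec j))).
by apply: is_derive_eq H _; rewrite /Fyy; field.
Qed.

Let Fx k z := pe z * (bil (dA k) z z / (2 * al z)) + p2 z * dot (db k) z
              + al z * p1 z * dT k.

Let isder_F_x k z : z != 0 -> is_derive x (evec k) (F^~ z) (Fx k z).
Proof.
move=> z0; have a0 : al z != 0 by rewrite gt_eqF// al0.
have Hq : is_derive x (evec k) (fun x' => bil (A x') z z) (bil (dA k) z z).
  apply: isder_sum => i; apply: isder_sum => j.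
  have H := isder_mul (isder_mul (HdA k i j) (isder_cst (z 0 i) x (evec k)))
                    (isder_cst (z 0 j) x (evec k)).
  by apply: is_derive_eq H _; rewrite !mulr0 !addr0.
have Hb : is_derive x (evec k) (fun x' => dot (b x') z) (dot (db k) z).
  apply: isder_sum => i.
  have H := isder_mul (Hdb k i) (isder_cst (z 0 i) x (evec k)).
  by apply: is_derive_eq H _; rewrite !mulr0 !addr0.
have Ha := isder_sqrt (f := fun x' => bil (A x') z z) (Apos z0) Hq.
have Hs := isder_mul Hb
  (isder_inv (f := fun x' => Num.sqrt (bil (A x') z z)) a0 Ha).
have [D _ _ _] := smooth_phi_derivable smW (inW z0).
have H := isder_mul Ha (isder_comp2 (t := T)
  (s := fun x' => dot (b x') z / Num.sqrt (bil (A x') z z)) D (HdT k) Hs).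
apply: is_derive_eq H _.
rewrite /Fx /pe /p0 /p1 /p2 /s -/(al z); field.
exact: a0.
Qed.

Let Fxy y k l :=
  (- (s y * p22 y * ds y (evec l))) * (bil (dA k) y y / (2 * al y))
  + pe y * (2 * bil (dA k) y (evec l) / (2 * al y)
            - bil (dA k) y y * bil S y (evec l) / (2 * al y ^+ 3))
  + p22 y * ds y (evec l) * dot (db k) y + p2 y * dot (db k) (evec l)
  + (bil S y (evec l) / al y * p1 y + al y * (p12 y * ds y (evec l))) * dT k.

Let isder_Fxy y k l : y != 0 -> is_derive y (evec l) (Fx k) (Fxy y k l).
Proof.
move=> y0; have a0 : al y != 0 by rewrite gt_eqF// al0.
have a20 : 2 * al y != 0 by rewrite mulf_neq0.
have Hq := isder_mul (isder_quad y (evec l) (dAsym k))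
                   (isder_inv (f := fun z => 2 * al z) a20 (isder_scale 2 (isder_al (evec l) y0))).
have H := isder_add (isder_add (isder_mul (isder_pe (evec l) y0) Hq)
            (isder_mul (isder_p2 (evec l) y0) (isder_dot (db k) y (evec l))))
            (isder_mul (isder_mul (isder_al (evec l) y0) (isder_p1 (evec l) y0))
                     (isder_cst (dT k) y (evec l))).
by apply: is_derive_eq H _; rewrite /Fxy; field.
Qed.

Variables (y : 'rV[R]_n) (c : R).
Hypothesis y0 : y != 0.
Hypothesis F0 : F x y != 0.
Hypothesis gU : fundamental_tensor F x y \in unitmx.
Hypothesis pde : p22 y = 2 * (p1 y - s y * p12 y).
Hypothesis dTE : forall k, dT k = 2 * c * b x 0 k.
Hypothesis closed : forall k l, db k 0 l = db l 0 k.
Let DQ := \sum_k bil (dA k) y y * y 0 k.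
Hypothesis alpha_hamel : forall l,
  \sum_k 2 * bil (dA k) y (evec l) * y 0 k =
  bil (dA l) y y + DQ / bil S y y * bil S y (evec l).
Hypothesis conf : \sum_k dot (db k) y * y 0 k =
  c * bil S y y + DQ * dot (b x) y / (2 * bil S y y).

(** Hamel's equations for F reduce to those for alpha^2, to the hypotheses on
    beta and b^2, and to the differential equation for phi.  The sums over k and
    j are first reduced to the contractions with y that these hypotheses
    evaluate, after which an identity of rational functions is left. *)
Lemma general_alpha_beta_radial : exists P : R, spray F x y = P *: y.
Proof.
have a0 : al y != 0 by rewrite gt_eqF// al0.
have dsy : \sum_j ds y (evec j) * y 0 j = 0.
  transitivity ((al y)^-1 * (\sum_j dot (b x) (evec j) * y 0 j)
    - s y / al y ^+ 2 * (\sum_j bil S y (evec j) * y 0 j)).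
    rewrite !mulr_sumr -sumrB; apply: eq_bigr => j _; rewrite /ds; field.
    exact: a0.
  by rewrite dot_sum bil_sumr al2// /s; field.
apply: (radial_spray_of_hamel (Fx := Fx) (Fy := Fy) (Fxy := Fxy y) (Fyy := Fyy y)).
- by move=> k; apply: filterS (near_neq0 y0) => z; exact: isder_F_x.
- by move=> i; apply: filterS (near_neq0 y0) => z; exact: isder_F_y.
- by move=> k l; exact: isder_Fxy.
- by move=> i j; exact: isder_Fyy.
- exact: F0.
- exact: gU.
- transitivity (pe y / al y * (\sum_j bil S y (evec j) * y 0 j)
     + p2 y * (\sum_j dot (b x) (evec j) * y 0 j)).
    rewrite !mulr_sumr -big_split /=; apply: eq_bigr => j _; rewrite /Fy; field.
    exact: a0.
  rewrite dot_sum bil_sumr al2// /F -/(al y) -/(s y) -/(p0 y) /pe /s; field.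
  exact: a0.
- move=> i.
  transitivity (\sum_j
      ((p22 y * dot (b x) (evec i) - s y * p22 y * (bil S y (evec i) / al y))
         * ds y (evec j)
       + pe y / al y * bil S (evec i) (evec j)
       + (- (pe y * bil S y (evec i) / al y ^+ 3)) * bil S y (evec j)) * y 0 j).
    apply: eq_bigr => j _; congr (_ * _); rewrite /Fyy (bil_sym (evec i) (evec j) Asym); field.
    exact: a0.
  rewrite sum_lincomb3 dsy !bil_sumr al2// (bil_sym (evec i) y Asym); field.
  exact: a0.
move=> l.
pose q := bil S y (evec l); pose e := ds y (evec l).
transitivity (\sum_k ((- (s y * p22 y * e) / (2 * al y)
       - pe y * q / (2 * al y ^+ 3)) * bil (dA k) y y
     + pe y / (2 * al y) * (2 * bil (dA k) y (evec l))
     + p22 y * e * dot (db k) y + p2 y * dot (db k) (evec l)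
     + (q / al y * p1 y + al y * (p12 y * e)) * dT k) * y 0 k).
  apply: eq_bigr => k _; congr (_ * _); rewrite /Fxy -/q -/e; field.
  exact: a0.
rewrite sum_lincomb5 -/DQ alpha_hamel conf -/q.
have -> : \sum_k dot (db k) (evec l) * y 0 k = dot (db l) y.
  by apply: eq_bigr => k _; rewrite dot_evec closed.
have -> : \sum_k dT k * y 0 k = 2 * c * dot (b x) y.
  by rewrite mulr_sumr; apply: eq_bigr => k _; rewrite dTE mulrA.
rewrite /Fx dTE pde /e /ds dot_evec -/q al2//.
have -> : dot (b x) y = s y * al y by rewrite /s divfK.
by field.
Qed.

End AlphaBeta.

(** * The spray of a Riemannian metric *)
Section Riemannian.
Context {R : realType} {n : nat}.
Implicit Types (x y v w z : 'rV[R]_n).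
Variables (U : set 'rV[R]_n) (A : 'rV[R]_n -> 'M[R]_n).
Hypothesis oU : open U.
Hypothesis Asm : forall i j, smooth_on U (fun x => A x i j).
Hypothesis Asym : forall x, U x -> (A x)^T = A x.
Hypothesis Apos : forall x y, U x -> y != 0 -> 0 < bil (A x) y y.

Definition dmetric x k : 'M[R]_n := \matrix_(i, j) pd k (fun z => A z i j) x.

(** [alpha_of] in a single chart. *)
Definition alpha_norm x y := Num.sqrt (bil (A x) y y).

Lemma near_open x : U x -> \forall z \near x, U z.
Proof. by move=> Ux; apply: open_nbhs_nbhs. Qed.

(** On a nonzero vector of the kernel the form would vanish. *)
Lemma posdef_unitmx (S : 'M[R]_n) :
  (forall z, z != 0 -> 0 < (z *m S *m z^T) 0 0) -> S \in unitmx.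
Proof.
move=> Sp; rewrite -row_free_unit -kermx_eq0; apply/eqP/row_matrixP => i.
rewrite row0; apply/eqP; apply: contraT => r0.
have := Sp _ r0.
have -> : row i (kermx S) *m S = 0.
  by apply/eqP; rewrite -sub_kermx row_sub.
by rewrite mul0mx mxE ltxx.
Qed.

Lemma metric_unitmx x : U x -> A x \in unitmx.
Proof.
by move=> Ux; apply: posdef_unitmx => z z0; rewrite -bilE; exact: Apos.
Qed.

Lemma isder_metric x k i j : U x ->
  is_derive x (evec k) (fun z => A z i j) (dmetric x k i j).
Proof.
move=> Ux; rewrite mxE; apply: differentiable_isder; exact: smooth_on_differentiable (Asm i j) Ux.
Qed.

Lemma dmetric_sym x k : U x -> (dmetric x k)^T = dmetric x k.
Proof.
move=> Ux; apply/matrixP => i j; rewrite !mxE; apply: pd_near.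
apply: filterS (near_open Ux) => z Uz.
by have := congr1 (fun M : 'M[R]_n => M i j) (Asym Uz); rewrite mxE.
Qed.

Lemma bil_ge0 x y : U x -> 0 <= bil (A x) y y.
Proof.
move=> Ux; have [->|y0] := eqVneq y 0; last by rewrite ltW// Apos.
by rewrite bilE mul0mx mul0mx mxE.
Qed.

Lemma sqfun_alpha x y : U x -> sqfun alpha_norm x y = bil (A x) y y.
Proof. by move=> Ux; rewrite /sqfun sqr_sqrtr// bil_ge0. Qed.

Lemma pdx_sqfun_alpha x k : U x ->
  pdx k (sqfun alpha_norm) x = fun y => bil (dmetric x k) y y.
Proof.
move=> Ux; apply/funext => y; apply: pd_isder.
have H : is_derive x (evec k) (fun z => bil (A z) y y) (bil (dmetric x k) y y).
  apply: isder_sum => i; apply: isder_sum => j.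
  have H := isder_mul (isder_mul (isder_metric k i j Ux) (isder_cst (y 0 i) x (evec k)))
                    (isder_cst (y 0 j) x (evec k)).
  by apply: is_derive_eq H _; rewrite !mulr0 !addr0.
apply: near_eq_is_derive H; apply: filterS (near_open Ux) => z Uz.
by rewrite sqfun_alpha.
Qed.

Lemma pdy_sqfun_alpha x i : U x ->
  pdy i (sqfun alpha_norm) x = fun y => 2 * bil (A x) y (evec i).
Proof.
move=> Ux; apply/funext => y; apply: pd_isder.
have H := isder_quad y (evec i) (Asym Ux).
apply: near_eq_is_derive H; near=> z; by rewrite sqfun_alpha.
Unshelve. all: by end_near. Qed.

Lemma fundamental_alpha x y : U x -> fundamental_tensor alpha_norm x y = A x.
Proof.
move=> Ux; apply/matrixP => i j; rewrite mxE /pdy -/(pdy i (sqfun alpha_norm)).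
rewrite (_ : (fun y => pd i (sqfun alpha_norm x) y) = pdy i (sqfun alpha_norm) x)//.
rewrite pdy_sqfun_alpha//.
rewrite (pd_isder (isder_scale 2 (isder_bil (A x) y (evec j) (evec i)))).
rewrite bil_evecl (bigD1 i)//= big1 ?addr0.
  rewrite !mxE !eqxx mulr1 mulKf//.
  by have := congr1 (fun M : 'M[R]_n => M i j) (Asym Ux); rewrite mxE.
by move=> k ki; rewrite !mxE eqxx (negbTE ki) mulr0.
Qed.

(** 4 a_{li} G^i, with G the spray of alpha: the Euler-Lagrange expression of
    alpha^2 along straight lines. *)
Definition lowered_spray x y l : R :=
  (\sum_k (2 * bil (dmetric x k) y (evec l)) * y 0 k) - bil (dmetric x l) y y.

Lemma spray_alpha x y : U x -> spray alpha_norm x y =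
  \row_i (4^-1 * \sum_l invmx (A x) i l * lowered_spray x y l).
Proof.
move=> Ux; apply/rowP => i; rewrite !mxE; congr (_ * _).
apply: eq_bigr => l _; rewrite fundamental_alpha//; congr (_ * _).
rewrite /lowered_spray pdx_sqfun_alpha//; congr (_ - _).
apply: eq_bigr => k _; congr (_ * _).
rewrite /pdy pdx_sqfun_alpha//; apply: pd_isder.
exact: isder_quad (dmetric_sym k Ux).
Qed.

(** Lowering the index of G = P y gives [lowered_spray] l = 4 P a_{lj} y^j.
    Contracting with y determines P, since [lowered_spray] l y^l is the
    derivative of alpha^2 along y. *)
Lemma alpha_hamel_of_radial x y (P : R) : U x -> y != 0 ->
  spray alpha_norm x y = P *: y ->
  forall l, \sum_k (2 * bil (dmetric x k) y (evec l)) * y 0 k =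
    bil (dmetric x l) y y
    + (\sum_k bil (dmetric x k) y y * y 0 k) / bil (A x) y y * bil (A x) y (evec l).
Proof.
move=> Ux y0 SP.
set DQ := \sum_k bil (dmetric x k) y y * y 0 k.
have E l : lowered_spray x y l = 4 * P * bil (A x) y (evec l).
  have h : invmx (A x) *m \col_l lowered_spray x y l = (4 * P) *: y^T.
    apply/colP => i; move/rowP/(_ i): SP; rewrite spray_alpha// !mxE => h.
    rewrite -mulrA -h mulrA divff// mul1r.
    by apply: eq_bigr => j _; rewrite [(\col__ _) _ _]mxE.
  have := congr1 (mulmx (A x)) h; rewrite mulKVmx ?metric_unitmx// => /colP/(_ l).
  rewrite mxE => ->; rewrite bil_evecr !mxE mulr_sumr.
  apply: eq_bigr => i _; rewrite !mxE.
  by have := congr1 (fun M : 'M[R]_n => M i l) (Asym Ux); rewrite mxE => ->; ring.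
have EE : \sum_l lowered_spray x y l * y 0 l = DQ.
  rewrite /lowered_spray; under eq_bigr do rewrite mulrBl.
  rewrite sumrB -/DQ.
  suff -> : \sum_l (\sum_k 2 * bil (dmetric x k) y (evec l) * y 0 k) * y 0 l = 2 * DQ.
    by ring.
  under eq_bigr do rewrite mulr_suml.
  rewrite exchange_big /= [RHS]mulr_sumr; apply: eq_bigr => k _.
  rewrite -(bil_sumr _ y y) [in RHS]mulr_suml [RHS]mulr_sumr.
  apply: eq_bigr => l _; ring.
have Q0 : bil (A x) y y != 0 by rewrite gt_eqF// Apos.
have PE : 4 * P = DQ / bil (A x) y y.
  rewrite -EE; apply: (mulIf Q0); rewrite divfK// -(bil_sumr (A x) y y) mulr_sumr.
  by apply: eq_bigr => l _; rewrite E; ring.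
by move=> l; have := E l; rewrite PE /lowered_spray => /eqP; rewrite subr_eq addrC => /eqP.
Qed.

End Riemannian.

(** * Geodesics of a Riemannian metric and radiality of its spray *)
Section Curves.
Context {R : realType} {n : nat}.
Implicit Types (x : R -> 'rV[R]_n) (t : R).

Lemma isder_rowP x t (dx : 'rV[R]_n) :
  is_derive t 1 x dx <-> forall i, is_derive t 1 (fun t => x t 0 i) (dx 0 i).
Proof.
split=> [[d <-] i|H].
  split; first by have /derivable_mxP := d; exact.
  by rewrite (derive_mx d) mxE.
have d : derivable x t 1.
  by apply/derivable_mxP => i j; rewrite ord1; have [] := H j.
split => //; rewrite (derive_mx d); apply/rowP => i; rewrite mxE.
by have [] := H i.
Qed.

Lemma isder_row (f : 'I_n -> R -> R) t (df : 'I_n -> R) :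
  (forall i, is_derive t 1 (f i) (df i)) ->
  is_derive t 1 (fun t => \row_i f i t) (\row_i df i).
Proof.
move=> H; apply/isder_rowP => i; rewrite mxE.
by apply: near_eq_is_derive (H i); near=> z; rewrite mxE.
Unshelve. all: by end_near. Qed.

(** If x runs on a line of direction v, the functions x_i v_j - x_j v_i are
    constant; differentiating them twice shows that velocity and acceleration
    are both parallel to v. *)
Lemma straight_acceleration (I : set R) x t : open I -> I t ->
  in_straight_line I x ->
  (forall t, I t -> derivable x t 1) -> derivable (derive1 x) t 1 ->
  derive1 x t != 0 ->
  exists P : R, derive1 (derive1 x) t = P *: derive1 x t.
Proof.
move=> oI It [p [v [v0 Hx]]] dx ddx nz.
have It_near s : I s -> \forall z \near s, I z.
  by move=> Is; apply: open_nbhs_nbhs.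
have par1 s i j : I s -> derive1 x s 0 i * v 0 j = derive1 x s 0 j * v 0 i.
  move=> Is; rewrite !derive1E.
  have /isder_rowP H := derivableP (dx s Is).
  have H1 := isder_sub (isder_mul (H i) (isder_cst (v 0 j) s 1))
                     (isder_mul (H j) (isder_cst (v 0 i) s 1)).
  have H2 : is_derive s 1
      (fun z => x z 0 i * v 0 j - x z 0 j * v 0 i) 0.
    apply: (near_eq_is_derive _ (isder_cst (p 0 i * v 0 j - p 0 j * v 0 i) s (1 : R))).
    apply: filterS (It_near s Is) => z /Hx[r ->]; rewrite !mxE; ring.
  have [_ e1] := H1; have [_ e2] := H2; move: e1; rewrite e2 => /eqP.
  by rewrite !mulr0 !addr0 eq_sym subr_eq0 => /eqP.
have par2 i j : derive1 (derive1 x) t 0 i * v 0 j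
              = derive1 (derive1 x) t 0 j * v 0 i.
  rewrite ![derive1 (derive1 x) t]derive1E.
  have /isder_rowP H := derivableP ddx.
  have H1 := isder_sub (isder_mul (H i) (isder_cst (v 0 j) t 1))
                     (isder_mul (H j) (isder_cst (v 0 i) t 1)).
  have H2 : is_derive t 1
      (fun z => derive1 x z 0 i * v 0 j - derive1 x z 0 j * v 0 i) 0.
    apply: (near_eq_is_derive _ (isder_cst (0 : R) t (1 : R))).
    by apply: filterS (It_near t It) => z Iz; rewrite par1// subrr.
  have [_ e1] := H1; have [_ e2] := H2; move: e1; rewrite e2 => /eqP.
  by rewrite !mulr0 !addr0 eq_sym subr_eq0 => /eqP.
have /rV0Pn[j vj] := v0.
have yE i : derive1 x t 0 i = derive1 x t 0 j / v 0 j * v 0 i.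
  by apply: (mulIf vj); rewrite (par1 t i j It); field.
have yj : derive1 x t 0 j != 0.
  apply: contraNneq nz => yj; apply/eqP/rowP => i.
  by rewrite yE yj mxE !mul0r.
exists (derive1 (derive1 x) t 0 j / derive1 x t 0 j).
apply/rowP => i; rewrite mxE (yE i); apply: (mulIf vj); rewrite par2; field.
by rewrite vj yj.
Qed.

End Curves.

Section AlphaGeodesics.
Context {R : realType} {n : nat}.
Implicit Types (x y v w z : 'rV[R]_n).
Variables (U : set 'rV[R]_n) (A : 'rV[R]_n -> 'M[R]_n).
Hypothesis oU : open U.
Hypothesis Asm : forall i j, smooth_on U (fun x => A x i j).
Hypothesis Asym : forall x, U x -> (A x)^T = A x.
Hypothesis Apos : forall x y, U x -> y != 0 -> 0 < bil (A x) y y.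

Local Notation J := ('I_n + 'I_n)%type.
Let X (u : J -> R) : 'rV[R]_n := \row_i u (inl i).
Let Y (u : J -> R) : 'rV[R]_n := \row_i u (inr i).

(* The geodesic equation x'' = - 2 G(x, x') as a first-order system, with
   positions indexed by inl and velocities by inr. *)
Let geod_field (u : J -> R) (j : J) : R :=
  match j with
  | inl i => u (inr i)
  | inr i => - 2 * (4^-1 * \sum_l inv_entry (A (X u)) i l *
      ((\sum_k (2 * \sum_p pd k (fun z => A z p l) (X u) * u (inr p)) * u (inr k))
       - \sum_p \sum_q pd l (fun z => A z p q) (X u) * u (inr p) * u (inr q)))
  end.

Let loclip_X (u0 : J -> R) (h : 'rV[R]_n -> R) : U (X u0) ->
  (forall x, U x -> differentiable h x) ->
  (forall i x, U x -> {for x, continuous (pd i h)}) ->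
  loclip u0 (fun u => h (X u)).
Proof. by move=> ? ? ?; apply: (@loclip_C1 R n J inl u0 U h). Qed.

Let cont_smooth2 (h : 'rV[R]_n -> R) i j x : smooth_on U h -> U x ->
  {for x, continuous (pd i (pd j h))}.
Proof.
move=> sm Ux; apply: differentiable_continuous.
exact: (sm [:: evec i; evec j]).
Qed.

Let pd_inv_entry i j k x : U x -> pd k (fun z => inv_entry (A z) i j) x =
  - \sum_q (\sum_p inv_entry (A x) i p * pd k (fun z => A z p q) x)
      * inv_entry (A x) q j.
Proof.
move=> Ux; apply: pd_isder.
have Hu : \forall z \near x, A z \in unitmx.
  by apply: filterS (near_open oU Ux) => z Uz; exact: metric_unitmx Uz.
have H := isder_inv_entry (evec k) i j Hu
            (fun i j => smooth_on_differentiable (Asm i j) Ux).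
apply: is_derive_eq H _; rewrite mxE; congr (- _); rewrite mxE.
have ux := nbhs_singleton Hu.
apply: eq_bigr => q _; rewrite inv_entryE// mxE; congr (_ * _).
by apply: eq_bigr => p _; rewrite inv_entryE// mxE.
Qed.

Let loclip_field u0 j : U (X u0) -> loclip u0 (geod_field^~ j).
Proof.
move=> U0; case: j => i /=; first exact: loclip_proj.
apply: loclip_mul; first exact: loclip_cst.
apply: loclip_mul; first exact: loclip_cst.
have pdA k p q : loclip u0 (fun u => pd k (fun z => A z p q) (X u)).
  apply: loclip_X => // [x|m x] Ux; first exact: smooth_on_differentiable_pd (Asm p q) Ux.
  exact: cont_smooth2.
apply: loclip_sum => l; apply: loclip_mul; last first.
  apply: loclip_add.
    apply: loclip_sum => k; apply: loclip_mul; last exact: loclip_proj.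
    apply: loclip_mul; first exact: loclip_cst.
    by apply: loclip_sum => p; apply: loclip_mul; last exact: loclip_proj.
  rewrite (_ : (fun u => _) = (fun u => (-1) *
     \sum_p \sum_q pd l (fun z => A z p q) (X u) * u (inr p) * u (inr q))).
    apply: loclip_mul; first exact: loclip_cst.
    apply: loclip_sum => p; apply: loclip_sum => q.
    apply: loclip_mul; last exact: loclip_proj.
    by apply: loclip_mul; last exact: loclip_proj.
  by apply/funext => u; rewrite mulN1r.
have dI x p q : U x -> differentiable (fun z => inv_entry (A z) p q) x.
  move=> Ux; apply: differentiable_inv_entry; first exact: metric_unitmx Ux.
  by move=> a b; exact: smooth_on_differentiable (Asm a b) Ux.
apply: (@loclip_X u0 (fun z => inv_entry (A z) i l)) => // [x|k x] Ux.
  exact: dI.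
have E : \forall z \near x, - (\sum_q
    (\sum_p inv_entry (A z) i p * pd k (fun z => A z p q) z)
      * inv_entry (A z) q l) = pd k (fun z => inv_entry (A z) i l) z.
  by apply: filterS (near_open oU Ux) => z Uz; rewrite pd_inv_entry.
have D : differentiable (fun z => - (\sum_q
    (\sum_p inv_entry (A z) i p * pd k (fun z => A z p q) z)
      * inv_entry (A z) q l)) x.
  apply: differentiableN; apply: differentiable_bigsum => q.
  apply: differentiableM; last exact: dI.
  apply: differentiable_bigsum => p; apply: differentiableM; first exact: dI.
  exact: smooth_on_differentiable_pd (Asm p q) Ux.
have C := differentiable_continuous D.
rewrite /prop_for /continuous_at -(nbhs_singleton E).
apply: cvg_trans; last exact: C.
exact: near_eq_cvg E.
Qed.

Let field_spray u i : U (X u) ->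
  geod_field u (inr i) = - 2 * spray (alpha_norm A) (X u) (Y u) 0 i.
Proof.
move=> Ux; rewrite (spray_alpha oU Asm Asym Apos)// mxE /=; congr (_ * (_ * _)).
apply: eq_bigr => l _; rewrite inv_entryE; last exact: metric_unitmx Ux.
congr (_ * _); rewrite /lowered_spray; congr (_ - _).
  apply: eq_bigr => k _; rewrite bil_evecr mxE; congr (_ * _ * _).
  by apply: eq_bigr => p _; rewrite !mxE.
by apply: eq_bigr => p _; apply: eq_bigr => q _; rewrite !mxE.
Qed.

(** The solution of the first-order system starts in the open set where x is in
    U and the velocity is nonzero, and stays there for a short time, during
    which the system is the geodesic equation. *)
Lemma geodesic_exists x0 y0 : U x0 -> y0 != 0 ->
  exists (d : R) (x : R -> 'rV[R]_n), [/\ 0 < d, x 0 = x0, derive1 x 0 = y0 &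
    geodesic U (alpha_norm A) `]- d, d[ x].
Proof.
move=> U0 y00.
pose u0 (j : J) := match j with inl i => x0 0 i | inr i => y0 0 i end.
have X0 : X u0 = x0 by apply/rowP => i; rewrite mxE.
have Y0 : Y u0 = y0 by apply/rowP => i; rewrite mxE.
have /rV0Pn[i0 _] := y00.
have [r [K [r0 K0 HK]]] := @loclip_family R J u0 (inl i0) J (fun j u => geod_field u j)
  (fun j => @loclip_field u0 j (eq_ind_r U U0 X0)).
have [h [u [h0 u00 Hu]]] := ode_exists r0 K0 HK.
have hX (t : R) : `|t| < h -> is_derive t 1 (X \o u) (Y (u t)).
  by move=> th; apply: isder_row => i; have [_] := Hu t th (inl i).
have hY (t : R) : `|t| < h -> is_derive t 1 (Y \o u) (\row_i geod_field (u t) (inr i)).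
  by move=> th; apply: isder_row => i; have [_] := Hu t th (inr i).
have cX : {for (0 : R), continuous (X \o u)}.
  apply: differentiable_continuous; apply/derivable1_diffP.
  by have [] := hX 0; rewrite ?normr0.
have cY : {for (0 : R), continuous (Y \o u)}.
  apply: differentiable_continuous; apply/derivable1_diffP.
  by have [] := hY 0; rewrite ?normr0.
have [d d0 Hd] : exists2 d : R, 0 < d & forall t : R, `|t| < d ->
    [/\ `|t| < h, U (X (u t)) & Y (u t) != 0].
  have : \forall t \near (0 : R), [/\ `|t| < h, U (X (u t)) & Y (u t) != 0].
    have n1 : \forall t \near (0 : R), `|t| < h by exact: nbhs0_lt.
    have n2 : \forall t \near (0 : R), U (X (u t)).
      by apply: cX; rewrite /= u00 X0; exact: near_open.
    have n3 : \forall t \near (0 : R), Y (u t) != 0.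
      by apply: (cvgr_neq0 _ cY); rewrite /= u00 Y0.
    by apply: filterS3 n1 n2 n3 => t *; split.
  move=> /nbhs_ballP[d /= d0 H]; exists d => // t td.
  by apply: H; rewrite -ball_normE /ball_ /= sub0r normrN.
have near_d (t : R) : `|t| < d -> \forall z \near t, `|z| < d.
  exact: (@cvgr_norm_lt _ _ _ _ _ id t (@cvg_id _ (nbhs t)) d).
have dX (t : R) : `|t| < d -> derive1 (X \o u) t = Y (u t).
  by move=> /Hd[th _ _]; rewrite derive1E; have [] := hX t th.
exists d, (X \o u); split => //=.
- by rewrite u00.
- by rewrite dX ?normr0// u00.
move=> t; rewrite /= in_itv /= -ltr_norml => td.
have [th Ut Yt] := Hd t td.
have ddX : is_derive t 1 (derive1 (X \o u)) (\row_i geod_field (u t) (inr i)).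
  by apply: near_eq_is_derive (hY t th); apply: filterS (near_d t td) => z zd; rewrite dX.
split => //.
- by have [] := hX t th.
- by rewrite dX.
rewrite derive1E; have [_ ->] := ddX; rewrite dX//.
suff -> : \row_i geod_field (u t) (inr i)
    = (- 2) *: spray (alpha_norm A) (X (u t)) (Y (u t)) by rewrite scaleNr addNr.
by apply/rowP => i; rewrite mxE field_spray// [RHS]mxE.
Qed.

(** By straightness, the geodesic through x with velocity y has acceleration
    parallel to y, and this acceleration is - 2 G(x, y). *)
Lemma flat_radial : projectively_flat U (alpha_norm A) ->
  forall x y, U x -> y != 0 -> exists P : R, spray (alpha_norm A) x y = P *: y.
Proof.
move=> flat x0 y0 U0 y00.
have [d [x [d0 x0E dx0 gx]]] := geodesic_exists U0 y00.
have oI : open (`]- d, d[%classic : set R) by exact: interval_open.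
have I0 : (`]- d, d[%classic : set R) 0 by rewrite /= in_itv /= oppr_lt0 d0.
have st := flat _ x oI (@interval_is_interval _ _) gx.
have [_ _ dd nz geq] := gx 0 I0.
have [P HP] := straight_acceleration oI I0 st
   (fun t It => let: And5 _ h _ _ _ := gx t It in h) dd nz.
exists (- (P / 2)).
move: geq; rewrite HP x0E dx0 => /eqP; rewrite addr_eq0 => /eqP E.
apply: (@scalerI _ _ (2 : R)) => //.
by rewrite scalerA mulrN mulrCA divff// mulr1 scaleNr E opprK.
Qed.

End AlphaGeodesics.

(** * Closed conformal one-forms *)
Section Conformal.
Context {R : realType} {n : nat}.
Implicit Types (x y v w z : 'rV[R]_n).
Variables (U : set 'rV[R]_n) (A : 'rV[R]_n -> 'M[R]_n).
Hypothesis oU : open U.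
Hypothesis Asm : forall i j, smooth_on U (fun x => A x i j).
Hypothesis Asym : forall x, U x -> (A x)^T = A x.
Hypothesis Apos : forall x y, U x -> y != 0 -> 0 < bil (A x) y y.
Variable b : 'rV[R]_n -> 'rV[R]_n.
Hypothesis bsm : forall i, smooth_on U (fun x => b x 0 i).
Variables (x : 'rV[R]_n) (c : R).
Hypothesis Ux : U x.
Hypothesis closed : forall i j,
  pd i (fun z => b z 0 j) x = pd j (fun z => b z 0 i) x.
Hypothesis conf : forall i j,
  2^-1 * (covariant_derivative A b x i j + covariant_derivative A b x j i)
  = c * A x i j.

Definition form_partial k : 'rV[R]_n := \row_j pd k (fun z => b z 0 j) x.

(* The dual vector of b at x. *)
Let v := b x *m invmx (A x).

Let dAT k i j : dmetric A x k i j = dmetric A x k j i.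
Proof.
by have := congr1 (fun M : 'M[R]_n => M i j) (dmetric_sym oU Asym k Ux); rewrite mxE.
Qed.

Let Au : A x \in unitmx. Proof. exact: metric_unitmx Ux. Qed.

Let vA : v *m A x = b x. Proof. by rewrite /v mulmxKV. Qed.

Let vE j : \sum_i invmx (A x) i j * b x 0 i = v 0 j.
Proof. by rewrite /v mxE; apply: eq_bigr => i _; rewrite mulrC. Qed.

Let invT i j : invmx (A x) i j = invmx (A x) j i.
Proof.
have := congr1 (fun M : 'M[R]_n => M j i) (trmx_inv (A x)).
by rewrite Asym// mxE.
Qed.

Let bil_dual y : bil (A x) y v = dot (b x) y.
Proof. by rewrite (bil_sym _ _ (Asym Ux)) bilE vA dotE. Qed.

Let christoffel_form i j :
  \sum_m christoffel A x m i j * b x 0 m =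
  2^-1 * \sum_l v 0 l * (dmetric A x i j l + dmetric A x j i l - dmetric A x l i j).
Proof.
rewrite mulr_sumr; under eq_bigr do rewrite /christoffel mulrAC mulr_sumr.
rewrite exchange_big /=; apply: eq_bigr => l _.
rewrite -vE mulr_suml mulr_sumr; apply: eq_bigr => m _.
by rewrite invT !mxE; ring.
Qed.

(** Closedness makes b_{i|j} symmetric, so conformality reads b_{i|j} = c a_ij,
    and the Christoffel symbols contracted with b only involve the dual vector.
*)
Lemma conformal_pd k j : pd k (fun z => b z 0 j) x = c * A x j k +
  2^-1 * \sum_l v 0 l * (dmetric A x j k l + dmetric A x k j l - dmetric A x l j k).
Proof.
have := conf j k; rewrite /covariant_derivative !christoffel_form.
rewrite (closed j k).
have -> : \sum_l v 0 l * (dmetric A x k j l + dmetric A x j k l - dmetric A x l k j) =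
    \sum_l v 0 l * (dmetric A x j k l + dmetric A x k j l - dmetric A x l j k).
  by apply: eq_bigr => l _; rewrite [dmetric A x l k j]dAT [X in _ * (X - _)]addrC.
by move=> <-; field.
Qed.

Let dot_dform k : \sum_j v 0 j * pd k (fun z => b z 0 j) x =
  c * b x 0 k + 2^-1 * bil (dmetric A x k) v v.
Proof.
have bE : b x 0 k = \sum_j v 0 j * A x j k by rewrite -[in LHS]vA mxE.
pose g1 j l := v 0 j * v 0 l * dmetric A x j k l.
pose g2 j l := dmetric A x k j l * v 0 j * v 0 l.
pose g3 j l := v 0 j * v 0 l * dmetric A x l j k.
transitivity (\sum_j (c * (v 0 j * A x j k)
   + 2^-1 * \sum_l (g1 j l + g2 j l - g3 j l))).
  apply: eq_bigr => j _; rewrite conformal_pd mulrDr mulrCA; congr (_ + _).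
  rewrite mulrCA mulr_sumr; congr (_ * _); apply: eq_bigr => l _.
  by rewrite /g1 /g2 /g3; ring.
rewrite big_split /= -!mulr_sumr -bE; congr (_ + _ * _).
under eq_bigr do rewrite sumrB big_split /=.
rewrite sumrB big_split /=.
suff -> : \sum_i \sum_j g3 i j = \sum_i \sum_j g1 i j.
  by rewrite addrAC subrr add0r.
rewrite exchange_big /=; apply: eq_bigr => i _; apply: eq_bigr => j _.
by rewrite /g1 /g3 [dmetric A x i k j]dAT [v 0 j * _]mulrC.
Qed.

Lemma isder_form k i : is_derive x (evec k) (fun z => b z 0 i) (form_partial k 0 i).
Proof. by rewrite mxE; apply: differentiable_isder; exact: smooth_on_differentiable (bsm i) Ux. Qed.

(** The derivative of b^2 is 2 b^j b_{j|k} = 2 c b_k: the derivative of the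
    inverse matrix contributes - v^i v^j (d a_ij / d x^k), which cancels the
    Christoffel symbols in v^j (d b_j / d x^k). *)
Lemma isder_sqnorm k : is_derive x (evec k)
  (fun z => \sum_i \sum_j invmx (A z) i j * b z 0 i * b z 0 j)
  (2 * c * b x 0 k).
Proof.
have Hu : \forall z \near x, A z \in unitmx.
  by apply: filterS (near_open oU Ux) => z Uz; exact: metric_unitmx Uz.
have dI i j := isder_invmx (evec k) i j Hu (fun i j => smooth_on_differentiable (Asm i j) Ux).
rewrite -/(dmetric A x k) in dI.
have H : is_derive x (evec k)
   (fun z => \sum_i \sum_j invmx (A z) i j * b z 0 i * b z 0 j)
   (\sum_i \sum_j
     (((- (invmx (A x) *m dmetric A x k *m invmx (A x))) i j * b x 0 i
       + invmx (A x) i j * form_partial k 0 i) * b x 0 j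
      + invmx (A x) i j * b x 0 i * form_partial k 0 j)).
  apply: isder_sum => i; apply: isder_sum => j.
  exact: (isder_mul (isder_mul (dI i j) (isder_form k i)) (isder_form k j)).
apply: is_derive_eq H _.
have E1 : \sum_i \sum_j invmx (A x) i j * b x 0 i * form_partial k 0 j =
    \sum_j v 0 j * pd k (fun z => b z 0 j) x.
  rewrite exchange_big /=; apply: eq_bigr => j _.
  by rewrite -vE mulr_suml; apply: eq_bigr => i _; rewrite mxE.
have E2 : \sum_i \sum_j invmx (A x) i j * form_partial k 0 i * b x 0 j =
    \sum_j v 0 j * pd k (fun z => b z 0 j) x.
  apply: eq_bigr => i _.
  rewrite -vE mulr_suml; apply: eq_bigr => j _; rewrite mxE invT; ring.
have E3 : \sum_i \sum_j (- (invmx (A x) *m dmetric A x k *m invmx (A x))) i j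
     * b x 0 i * b x 0 j = - bil (dmetric A x k) v v.
  rewrite -/(bil _ (b x) (b x)) !bilE mulmxN mulNmx mxE; congr (- _).
  rewrite /v trmx_mul trmx_inv Asym//.
  by congr (fun_of_matrix _ 0 0); rewrite !mulmxA.
transitivity (- bil (dmetric A x k) v v
   + \sum_j v 0 j * pd k (fun z => b z 0 j) x
   + \sum_j v 0 j * pd k (fun z => b z 0 j) x).
  rewrite -E3 -{1}E2 -E1 -!big_split /=; apply: eq_bigr => i _.
  by rewrite -!big_split /=; apply: eq_bigr => j _; rewrite mulrDl.
by rewrite dot_dform; field.
Qed.

(** The Christoffel symbols contracted twice with y are [lowered_spray], which
    is proportional to a_{lj} y^j when the spray of alpha is radial; contracting
    with the dual vector of b then gives a multiple of beta. *)
Lemma conformal_derivative y (l0 : R) :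
  (forall l, lowered_spray A x y l = l0 * bil (A x) y (evec l)) ->
  \sum_k dot (form_partial k) y * y 0 k = c * bil (A x) y y + l0 * dot (b x) y / 2.
Proof.
move=> Hl.
have E l : \sum_k \sum_j (dmetric A x j k l + dmetric A x k j l - dmetric A x l j k)
     * y 0 j * y 0 k = lowered_spray A x y l.
  have h1 : \sum_k \sum_j dmetric A x j k l * y 0 j * y 0 k =
     \sum_k bil (dmetric A x k) y (evec l) * y 0 k.
    rewrite exchange_big /=; apply: eq_bigr => k _.
    by rewrite bil_evecr mulr_suml; apply: eq_bigr => j _; ring.
  have h2 : \sum_k \sum_j dmetric A x k j l * y 0 j * y 0 k =
     \sum_k bil (dmetric A x k) y (evec l) * y 0 k.
    by apply: eq_bigr => k _; rewrite bil_evecr mulr_suml.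
  have h3 : \sum_k \sum_j dmetric A x l j k * y 0 j * y 0 k = bil (dmetric A x l) y y.
    by rewrite exchange_big.
  rewrite /lowered_spray.
  transitivity (\sum_k \sum_j dmetric A x j k l * y 0 j * y 0 k
    + \sum_k \sum_j dmetric A x k j l * y 0 j * y 0 k
    - \sum_k \sum_j dmetric A x l j k * y 0 j * y 0 k).
    rewrite -big_split -sumrB /=; apply: eq_bigr => k _.
    by rewrite -big_split -sumrB /=; apply: eq_bigr => j _; ring.
  rewrite h1 h2 h3; congr (_ - _); rewrite -big_split /=.
  by apply: eq_bigr => k _; ring.
transitivity (\sum_k \sum_j (c * (A x j k * y 0 j * y 0 k) + 2^-1 * \sum_l
    v 0 l * ((dmetric A x j k l + dmetric A x k j l - dmetric A x l j k) * y 0 j * y 0 k))).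
  apply: eq_bigr => k _; rewrite /dot mulr_suml; apply: eq_bigr => j _.
  rewrite mxE conformal_pd !mulrDl -!mulrA; congr (_ + _ * _).
  by rewrite mulr_suml; apply: eq_bigr => l _; ring.
under eq_bigr do rewrite big_split /= -!mulr_sumr.
rewrite big_split /= -!mulr_sumr exchange_big /= -/(bil _ y y); congr (_ + _).
under eq_bigr do rewrite exchange_big /=.
rewrite exchange_big /=.
transitivity (2^-1 * \sum_l l0 * (bil (A x) y (evec l) * v 0 l)).
  congr (_ * _); apply: eq_bigr => l _.
  under eq_bigr do rewrite -mulr_sumr.
  by rewrite -mulr_sumr E Hl; ring.
by rewrite -mulr_sumr bil_sumr bil_dual mulrC.
Qed.

End Conformal.

(** * Geodesics of a radial spray are straight *)
Section RadialSpray.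
Context {R : realType} {n : nat}.

Lemma zero_derive_constant (I : set R) (f : R -> R) : is_interval I ->
  (forall t, I t -> is_derive t 1 f 0) -> forall s t, I s -> I t -> f s = f t.
Proof.
move=> itvI Hf.
have key s t : I s -> I t -> s < t -> f s = f t.
  move=> Is It st.
  have inI r : r \in `[s, t]%R -> I r by rewrite in_itv /=; exact: itvI.
  have [r rI E] := @MVT R f (fun=> 0) s t st
    (fun r rI => Hf r (inI r (subset_itv_oo_cc rI)))
    (derivable_within_continuous
      (fun r rI => @ex_derive _ _ _ _ _ _ _ (Hf r (inI r rI)))).
  by move: E => /eqP; rewrite mul0r subr_eq0 => /eqP ->.
move=> s t Is It; case: (ltgtP s t) => [st|ts|->//]; first exact: key.
by apply/esym; exact: key.
Qed.

(** Along a geodesic x'' = l x' with l a function of time, about which nothing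
    else has to be known: the derivative of x' / |x'| vanishes identically, with
    |x'| the Euclidean norm.  Hence x' keeps the direction v that it has at one
    time, and the functions x_i v_j - x_j v_i are constant. *)
Lemma radial_projectively_flat (U : set 'rV[R]_n)
    (F : 'rV[R]_n -> 'rV[R]_n -> R) : (0 < n)%N ->
  (forall x y, U x -> y != 0 -> exists P : R, spray F x y = P *: y) ->
  projectively_flat U F.
Proof.
move=> n0 rad I x oI itvI gx.
case: (pselect (exists t, I t)) => [[t0 It0]|noI]; last first.
  exists 0, (evec (Ordinal n0)); split.
    by apply/rV0Pn; exists (Ordinal n0); rewrite mxE !eqxx oner_neq0.
  by move=> t It; exfalso; apply: noI; exists t.
have [x' x'E] : exists x', x' = derive1 x by exists (derive1 x).
have d1x t i : I t -> is_derive t 1 (fun z => x z 0 i) (x' t 0 i).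
  move=> /gx[_ d _ _ _]; move: i; apply/isder_rowP.
  by split => //; rewrite x'E derive1E.
have d2x t : I t -> exists l : R, forall i,
    is_derive t 1 (fun z => x' z 0 i) (l * x' t 0 i).
  move=> /gx[Ut _ d nz E].
  have [P HP] := rad _ _ Ut nz.
  exists (- (2 * P)) => i.
  have := derivableP d; rewrite -derive1E => /isder_rowP/(_ i).
  move: E; rewrite HP => /eqP; rewrite addr_eq0 => /eqP ->.
  by rewrite !mxE mulNr mulrA x'E.
pose N t := \sum_i x' t 0 i ^+ 2.
have N0 t : I t -> 0 < N t.
  move=> /gx[_ _ _]; rewrite -x'E => /rV0Pn[j xj] _; rewrite /N (bigD1 j)//=.
  by rewrite ltr_wpDr ?sumr_ge0// => [i _|]; rewrite ?sqr_ge0 ?exprn_even_gt0.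
have e0 i t : I t -> is_derive t 1 (fun z => x' z 0 i / Num.sqrt (N z)) 0.
  move=> It; have [l Hl] := d2x t It.
  have HN : is_derive t 1 N (2 * l * N t).
    have H : is_derive t 1 N (\sum_i (l * x' t 0 i * x' t 0 i + x' t 0 i * (l * x' t 0 i))).
      apply: isder_sum => j; apply: (near_eq_is_derive _ (isder_mul (Hl j) (Hl j))).
      by near=> z; rewrite expr2.
    apply: is_derive_eq H _; rewrite /N mulr_sumr; apply: eq_bigr => j _; ring.
  have s0 : Num.sqrt (N t) != 0 by rewrite gt_eqF// sqrtr_gt0 N0.
  have HS := isder_inv (f := fun z => Num.sqrt (N z)) s0 (isder_sqrt (N0 t It) HN).
  have H := isder_mul (Hl i) HS.
  apply: is_derive_eq H _.
  rewrite -{2}(sqr_sqrtr (ltW (N0 t It))); field.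
  exact: s0.
have [v vE] : exists v, v = x' t0 by exists (x' t0).
have v0 : v != 0 by have [_ _ _] := gx t0 It0; rewrite vE x'E.
have dirE t i : I t -> x' t 0 i = Num.sqrt (N t) / Num.sqrt (N t0) * v 0 i.
  move=> It.
  have s0 : Num.sqrt (N t) != 0 by rewrite gt_eqF// sqrtr_gt0 N0.
  have := zero_derive_constant itvI (e0 i) It It0.
  rewrite -vE => /= E.
  by rewrite -[LHS](divfK s0) E mulrC mulrA mulrAC.
have cross i j t : I t ->
    x t 0 i * v 0 j - x t 0 j * v 0 i = x t0 0 i * v 0 j - x t0 0 j * v 0 i.
  move=> It.
  apply: (zero_derive_constant (f := fun t => x t 0 i * v 0 j - x t 0 j * v 0 i)
            itvI _ It It0) => {t It} t It.
  have H := isder_sub (isder_mul (d1x t i It) (isder_cst (v 0 j) t 1))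
                    (isder_mul (d1x t j It) (isder_cst (v 0 i) t 1)).
  by apply: is_derive_eq H _; rewrite !dirE//; ring.
exists (x t0), v; split => // t It.
have /rV0Pn[j vj] := v0.
exists ((x t 0 j - x t0 0 j) / v 0 j).
apply/rowP => i; rewrite !mxE; apply: (mulIf vj).
rewrite mulrDl mulrAC divfK//.
have := cross i j t It; lra.
Unshelve. all: by end_near. Qed.

End RadialSpray.

(** * The Cauchy-Schwarz inequality for a one-form and a vector *)
Section CauchySchwarz.
Context {R : realType} {n : nat}.

Lemma bil_lincombl (S : 'M[R]_n) (u w z : 'rV[R]_n) (p q : R) :
  bil S (p *: u + q *: w) z = p * bil S u z + q * bil S w z.
Proof.
rewrite /bil !mulr_sumr -big_split /=; apply: eq_bigr => i _.
rewrite !mulr_sumr -big_split /=; apply: eq_bigr => j _.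
by rewrite !mxE; ring.
Qed.

Lemma bil_lincomb (S : 'M[R]_n) (u w : 'rV[R]_n) (p q : R) : S^T = S ->
  bil S (p *: u + q *: w) (p *: u + q *: w)
  = p ^+ 2 * bil S u u + 2 * p * q * bil S u w + q ^+ 2 * bil S w w.
Proof.
move=> Ss; rewrite bil_lincombl ![bil S _ (_ + _)]bil_sym// !bil_lincombl.
by rewrite (bil_sym w u Ss); ring.
Qed.

(** Positivity of S at the combination Q v - (S v y) y, where v is the dual
    vector of b and Q = S y y. *)
Lemma dual_cauchy_schwarz (S : 'M[R]_n) (b y : 'rV[R]_n) : S^T = S ->
  (forall z, z != 0 -> 0 < bil S z z) -> S \in unitmx -> y != 0 ->
  0 <= bil (invmx S) b b /\
  dot b y ^+ 2 <= bil S y y * bil (invmx S) b b.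
Proof.
move=> Ss Sp Su y0.
have Sge z : 0 <= bil S z z.
  have [->|z0] := eqVneq z 0; last by rewrite ltW// Sp.
  by rewrite bilE !mul0mx mxE.
pose v := b *m invmx S.
have vS : v *m S = b by rewrite /v mulmxKV.
have tE : bil (invmx S) b b = bil S v v.
  by rewrite !bilE vS /v trmx_mul trmx_inv Ss mulmxA.
have dE : dot b y = bil S v y by rewrite bilE vS dotE.
rewrite tE; split => //.
have := Sge (bil S y y *: v + (- bil S v y) *: y).
rewrite bil_lincomb// dE.
have := Sp y y0; set Q := bil S y y; set t := bil S v v; set e := bil S v y.
move=> Q0 H; rewrite -(ler_pM2l Q0); lra.
Qed.

End CauchySchwarz.

(** * Projective flatness of general (alpha, beta)-metrics *)
Theorem theorem1p2 (R : realType) (n : nat) (hn : (2 <= n)%N)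
    (M : manifold R n)
    (a : chart R n M -> 'rV[R]_n -> 'M[R]_n)
    (b : chart R n M -> 'rV[R]_n -> 'rV[R]_n)
    (bo : \bar R) (phi : R -> R -> R)
    (ha : riemannian_metric a)
    (hb : one_form b)
    (hbo : (0 < bo)%E)
    (hphi_smooth : smooth_phi bo phi)
    (hphi_pos : forall t s, phi_domain bo (t, s) -> 0 < phi t s)
    (hb_lt : forall c x, atlas c -> cimg c x ->
      ((Num.sqrt (sqnorm a b c x))%:E < bo)%E)
    (hF : finsler_metric (general_alpha_beta phi a b))
    (hpde : forall t s, phi_domain bo (t, s) ->
      d2 (d2 phi) t s = 2 * (d1 phi t s - s * d2 (d1 phi) t s))
    (ha_flat : locally_projectively_flat (alpha_of a))
    (hb_closed : closed_form b)
    (hb_conf : conformal_form a b) :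
  locally_projectively_flat (general_alpha_beta phi a b).
Proof.
move=> p; have [c [ac cp flat]] := ha_flat p; exists c; split; [exact: ac|exact: cp|].
have [_ oU _ _ _] := atlas_chart ac.
have [/(_ c ac)[asm asym apos'] _] := ha.
have [/(_ c ac) bsm _] := hb.
have [/(_ c ac)[_ _ Fpos _ gpos] _] := hF.
have [k hk] := hb_conf.
have [W [_ domW smW]] := hphi_smooth.
have apos x y : cimg c x -> y != 0 -> 0 < bil (a c x) y y.
  by move=> Ux y0; rewrite bilE; exact: apos'.
have dom x y : cimg c x -> y != 0 ->
    phi_domain bo (sqnorm a b c x, dot (b c x) y / Num.sqrt (bil (a c x) y y)).
  move=> Ux y0; have Q0 := apos x y Ux y0.
  have [t0 CS] := dual_cauchy_schwarz (b c x) (asym x Ux)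
    (fun z z0 => apos x z Ux z0) (metric_unitmx apos Ux) y0.
  rewrite -[bil (invmx _) _ _]/(sqnorm a b c x) in t0 CS.
  exists (Num.sqrt (sqnorm a b c x)); split; last exact: hb_lt.
    by rewrite sqr_sqrtr.
  rewrite /= -sqrtr_sqr ler_sqrt// exprMn exprVn (sqr_sqrtr (ltW Q0)).
  by rewrite ler_pdivrMr// mulrC.
apply: radial_projectively_flat; first exact: ltnW hn.
move=> x y Ux y0.
have [P HP] := flat_radial oU asm asym apos flat Ux y0.
have hamel := alpha_hamel_of_radial oU asm asym apos Ux y0 HP.
have cl i j : pd i (fun z => b c z 0 j) x = pd j (fun z => b c z 0 i) x.
  exact: hb_closed.
have cf i j := hk c x i j ac Ux.
apply: (@general_alpha_beta_radial R n (a c) (b c) (sqnorm a b c) phi W x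
  (asym x Ux) (fun z => apos x z Ux) smW (fun z z0 => domW _ (dom x z Ux z0))
  (dmetric (a c) x) (form_partial (b c) x) (fun i => 2 * k (cbwd c x) * b c x 0 i)
  (fun m i j => isder_metric asm m i j Ux) (fun m => dmetric_sym oU asym m Ux)
  (fun m i => isder_form bsm Ux m i)
  (fun m => isder_sqnorm oU asm asym apos bsm Ux cl cf m)
  y (k (cbwd c x)) y0).
- by rewrite gt_eqF//; exact: Fpos.
- by apply: posdef_unitmx => z z0; exact: gpos.
- exact: hpde (dom x y Ux y0).
- by [].
- by move=> i j; rewrite !mxE.
- exact: hamel.
rewrite (conformal_derivative oU asym apos Ux cl cf
  (l0 := (\sum_k bil (dmetric (a c) x k) y y * y 0 k) / bil (a c x) y y)).
  by congr (_ + _); field; rewrite gt_eqF// apos.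
by move=> l; rewrite /lowered_spray hamel addrC addKr.
Qed.
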